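(* Let $(G,P,\theta)$ be an algebraic dynamical system such that $G$ is abelian, $P$ is directed, $N_p=[G:\theta_p(G)]<\infty$ for all $p\in P$, and the canonical representation $\pi\colon\mathcal{Q}(G\rtimes_\theta P)\to\mathcal{L}(\ell^2(G))$ is faithful. Assume moreover that for all $p,q\in P$ with $p\neq q$ there exists $g\in G$ of infinite order such that the group endomorphism $\Phi_{p,q}$ of $G$ given by $\Phi_{p,q}(h)=\theta_p(h)\theta_q(h^{-1})$ is injective on the subgroup $\langle g\rangle\cong\mathbb{Z}$. Then every conditional expectation $\mathcal{E}\colon\mathcal{L}(\ell^2(G))\to W^*(G)$ satisfies $$\mathcal{E}(\pi(u_gs_ps_q^*u_h^* ))=\delta_{p,q}\,N_p^{-1}\,\pi(u_{gh^{-1}})\quad\text{for all } g,h\in G,\ p,q\in P.$$ In particular, every conditional expectation $\mathcal{E}\colon\mathcal{L}(\ell^2(G))\to W^*(G)$ restricts to the conditional expectation $E_0\colon\pi(\mathcal{Q}(G\rtimes_\theta P))\to\pi(C^*(G))$ given by $$E_0(\pi(u_gs_ps_q^*u_h^* ))=\delta_{p,q}\,N_p^{-1}\,\pi(u_{gh^{-1}})\quad\text{for all } g,h\in G,\ p,q\in P.$$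
   Context: An algebraic dynamical system is a triple $(G,P,\theta)$ where $G$ is a countable discrete group; $P$ is a right LCM semigroup, i.e. a countable left cancellative monoid in which the intersection of two principal right ideals is either empty or another principal right ideal; and $\theta$ is an action of $P$ on $G$ by injective group endomorphisms $\theta_p$ which respects the order: $pP\cap qP=rP$ implies $\theta_p(G)\cap\theta_q(G)=\theta_r(G)$. $P$ is directed if it is directed with respect to $p\geq q \Leftrightarrow p\in qP$, i.e. $pP\cap qP\neq\emptyset$ for all $p,q\in P$. For directed $P$, the boundary quotient $\mathcal{Q}(G\rtimes_\theta P)$ is the universal $C^*$-algebra generated by a unitary representation $u$ of $G$ and a representation $s$ of the monoid $P$ by isometries satisfying (I) $s_pu_g=u_{\theta_p(g)}s_p$; (II) $s_p^*u_gs_q=u_{g_1}s_{p'}s_{q'}^*u_{g_2}$ if $g=\theta_p(g_1)\theta_q(g_2)$ and $pP\cap qP=pp'P$, $pp'=qq'$, and $s_p^*u_gs_q=0$ otherwise; (III) $\sum_{[g]\in G/\theta_p(G)}u_gs_ps_p^*u_g^*=1$ whenever $N_p<\infty$. The canonical representation $\pi\colon\mathcal{Q}(G\rtimes_\theta P)\to\mathcal{L}(\ell^2(G))$ is given by $\pi(u_gs_p)\xi_h=\xi_{g\theta_p(h)}$, where $(\xi_h)_{h\in G}$ is the standard orthonormal basis of $\ell^2(G)$. $C^*(G)$ is identified with the $C^*$-subalgebra of $\mathcal{Q}(G\rtimes_\theta P)$ generated by $\{u_g\mid g\in G\}$, and $W^*(G)\subset\mathcal{L}(\ell^2(G))$ is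 the group von Neumann algebra of $G$, i.e. the von Neumann algebra generated by $\pi(C^*(G))$. *)

(* Defs.v *)
From HB Require Import structures.
From mathcomp Require Import all_boot all_order all_algebra.
From mathcomp Require Import finmap.
From mathcomp Require Import all_classical all_reals all_analysis.
From mathcomp Require Import complex ring lra.

Set Implicit Arguments.
Unset Strict Implicit.
Unset Printing Implicit Defensive.

Import Order.TTheory GRing.Theory Num.Theory.
Import numFieldNormedType.Exports.
Import ComplexField.Normc.

Local Open Scope classical_set_scope.
Local Open Scope ring_scope.
Local Open Scope complex_scope.

Section AlgebraicDynamicalSystem.
Local Open Scope group_scope.

Definition principal_ideal (P : monoidType) (p : P) : set P :=
  [set x | exists q, x = p * q].

Definition left_cancellative (P : monoidType) : Prop :=
  forall p q r : P, p * q = p * r -> q = r.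

Definition right_LCM (P : monoidType) : Prop :=
  [/\ countable [set: P], left_cancellative P &
      forall p q : P,
        principal_ideal p `&` principal_ideal q = set0 \/
        exists r, principal_ideal p `&` principal_ideal q = principal_ideal r].

Definition directed (P : monoidType) : Prop :=
  forall p q : P, principal_ideal p `&` principal_ideal q !=set0.

Definition algebraic_dynamical_system (G : groupType) (P : monoidType)
    (theta : P -> G -> G) : Prop :=
  [/\ countable [set: G], right_LCM P,
      (forall p, {morph theta p : g h / g * h}) /\
        (forall p, injective (theta p)),
      (forall g, theta 1 g = g) /\
        (forall p q g, theta (p * q) g = theta p (theta q g)) &
      forall p q r : P,
        principal_ideal p `&` principal_ideal q = principal_ideal r ->
        range (theta p) `&` range (theta q) = range (theta r)].

Definition cosets (G : groupType) (P : monoidType) (theta : P -> G -> G)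
    (p : P) : set (set G) :=
  [set A | exists g : G, A = [set g * x | x in range (theta p)]].

(* N_p = [G : theta_p(G)]; a junk value (0) when the index is infinite. *)
Definition Nindex (G : groupType) (P : monoidType) (theta : P -> G -> G)
    (p : P) : nat := #|` fset_set (cosets theta p)|.

Definition coset_representatives (G : groupType) (P : monoidType)
    (theta : P -> G -> G) (p : P) (T : {fset G}) : Prop :=
  forall g : G, exists! t, t \in T /\ range (theta p) (t^-1 * g).

Definition cyclic_subgroup (G : groupType) (g : G) : set G :=
  [set x | exists n : nat, x = g ^+ n \/ x = g ^- n].

Definition infinite_order (G : groupType) (g : G) : Prop :=
  forall n : nat, (0 < n)%N -> g ^+ n <> 1.

Definition Phi (G : groupType) (P : monoidType) (theta : P -> G -> G)
    (p q : P) (h : G) : G := theta p h * theta q (h^-1).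

End AlgebraicDynamicalSystem.

HB.mixin Record isCStarAlgebra (R : realType) A of GRing.Algebra R[i] A := {
  star : A -> A;
  cnorm : A -> R;
  starK : involutive star;
  starD : {morph star : x y / x + y};
  starZ : forall (a : R[i]) (x : A), star (a *: x) = a^* *: star x;
  starM : forall x y : A, star (x * y) = star y * star x;
  cnorm_eq0 : forall x : A, cnorm x = 0 -> x = 0;
  cnormD : forall x y : A, cnorm (x + y) <= cnorm x + cnorm y;
  cnormZ : forall (a : R[i]) (x : A), cnorm (a *: x) = normc a * cnorm x;
  cnormM : forall x y : A, cnorm (x * y) <= cnorm x * cnorm y;
  cnorm_complete : forall x : nat -> A,
    (forall e : R, 0 < e -> exists N : nat, forall m n : nat,
       (N <= m)%N -> (N <= n)%N -> cnorm (x m - x n) < e) ->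
    exists l : A, cnorm (x n - l) @[n --> \oo] --> (0 : R);
  cstar_identity : forall x : A, cnorm (star x * x) = cnorm x ^+ 2
}.

#[short(type="cstarAlgType")]
HB.structure Definition CStarAlgebra (R : realType) :=
  {A of GRing.Algebra R[i] A & isCStarAlgebra R A}.

Section CStarGeneration.
Variables (R : realType) (A : cstarAlgType R).

Definition cstar_subalgebra (B : set A) : Prop :=
  [/\ B 0 /\ (forall (a : R[i]) x y, B x -> B y -> B (a *: x + y)),
      forall x y, B x -> B y -> B (x * y),
      forall x, B x -> B (star x) &
      forall (x : nat -> A) l, (forall n, B (x n)) ->
        cnorm (x n - l) @[n --> \oo] --> (0 : R) -> B l].

Definition cstar_generated (X : set A) : set A := smallest cstar_subalgebra X.

End CStarGeneration.

Section BoundaryQuotient.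
Variables (R : realType) (G : groupType) (P : monoidType).
Variable theta : P -> G -> G.

Definition unitary_representation (A : cstarAlgType R) (u : G -> A) : Prop :=
  [/\ u 1%g = 1, forall g h, u (g * h)%g = u g * u h &
      forall g, star (u g) * u g = 1 /\ u g * star (u g) = 1].

Definition isometric_representation (A : cstarAlgType R) (s : P -> A) : Prop :=
  [/\ s 1%g = 1, forall p q, s (p * q)%g = s p * s q &
      forall p, star (s p) * s p = 1].

Definition relationI (A : cstarAlgType R) (u : G -> A) (s : P -> A) : Prop :=
  forall p g, s p * u g = u (theta p g) * s p.

Definition relationII_data (p q : P) (g g1 g2 : G) (p' q' : P) : Prop :=
  [/\ g = (theta p g1 * theta q g2)%g,
      principal_ideal p `&` principal_ideal q = principal_ideal (p * p')%g &
      (p * p' = q * q')%g].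

Definition relationII (A : cstarAlgType R) (u : G -> A) (s : P -> A) : Prop :=
  (forall p q g g1 g2 p' q', relationII_data p q g g1 g2 p' q' ->
     star (s p) * u g * s q = u g1 * s p' * star (s q') * u g2) /\
  (forall p q g, ~ (exists g1 g2 p' q', relationII_data p q g g1 g2 p' q') ->
     star (s p) * u g * s q = 0).

(* The sum over G/theta_p(G) is taken over an arbitrary system of coset
   representatives; by (I) its value does not depend on the choice. *)
Definition relationIII (A : cstarAlgType R) (u : G -> A) (s : P -> A) : Prop :=
  forall p, finite_set (cosets theta p) ->
  forall T : {fset G}, coset_representatives theta p T ->
    \sum_(g <- T) u g * s p * star (s p) * star (u g) = 1.

Definition boundary_relations (A : cstarAlgType R) (u : G -> A) (s : P -> A) :
    Prop :=
  [/\ unitary_representation u, isometric_representation s,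
      relationI u s, relationII u s & relationIII u s].

(* Uniqueness of f is automatic, since Q is generated by u and s. *)
Definition boundary_quotient (Q : cstarAlgType R) (u : G -> Q) (s : P -> Q) :
    Prop :=
  [/\ boundary_relations u s,
      cstar_generated (range u `|` range s) = [set: Q] &
      forall (A : cstarAlgType R) (v : G -> A) (t : P -> A),
        boundary_relations v t ->
        exists f : {lrmorphism Q -> A},
          [/\ forall x, f (star x) = star (f x),
              forall g, f (u g) = v g & forall p, f (s p) = t p]].

End BoundaryQuotient.

Section SquareSummable.
Variables (R : realType) (T : choiceType).
Implicit Types f g : T -> R[i].

Definition sumsq f : \bar R := \esum_(x in [set: T]) (normc (f x) ^+ 2)%:E.

Definition square_summable : {pred T -> R[i]} :=
  fun f => `[< (sumsq f < +oo)%E >].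

Lemma sumsq_ge0 f : (0 <= sumsq f)%E.
Proof. by apply: esum_ge0 => x _; rewrite lee_fin sqr_ge0. Qed.

Lemma normcD_sq (a b : R[i]) :
  normc (a + b) ^+ 2 <= 2 * normc a ^+ 2 + 2 * normc b ^+ 2.
Proof.
have sq (c : R[i]) : normc c ^+ 2 = complex.Re c ^+ 2 + complex.Im c ^+ 2.
  by case: c => x y /=; rewrite sqr_sqrtr// addr_ge0// sqr_ge0.
rewrite !sq; case: a b => [x y] [x' y'] /=.
have := sqr_ge0 (x - x'); have := sqr_ge0 (y - y'); nra.
Qed.

Lemma esumZ_le (c : R) (a : T -> \bar R) : 0 <= c ->
  (forall x, 0 <= a x)%E ->
  (\esum_(x in [set: T]) (c%:E * a x) <= c%:E * \esum_(x in [set: T]) a x)%E.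
Proof.
move=> c0 a0; apply: ge_ereal_sup => _ [X finX <-].
rewrite -ge0_mule_fsumr//; apply: lee_wpmul2l; first by rewrite lee_fin.
by apply: esum_ge; exists X.
Qed.

Lemma sumsqZ (a : R[i]) f :
  (sumsq (a *: f)%R <= (normc a ^+ 2)%:E * sumsq f)%E.
Proof.
rewrite [leLHS](_ : _ =
    \esum_(x in [set: T]) ((normc a ^+ 2)%:E * (normc (f x) ^+ 2)%:E)%E).
  by apply: esumZ_le => *; rewrite ?lee_fin sqr_ge0.
by apply: eq_esum => x _; rewrite -EFinM -exprMn -normcM.
Qed.

Lemma sumsqD f g : (sumsq (f + g)%R <= 2%:E * sumsq f + 2%:E * sumsq g)%E.
Proof.
pose F (h : T -> R[i]) x := (normc (h x) ^+ 2)%:E.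
have F0 h x : (0 <= F h x)%E by rewrite lee_fin sqr_ge0.
apply: (@le_trans _ _ (\esum_(x in [set: T]) (2%:E * F f x)
                       + \esum_(x in [set: T]) (2%:E * F g x))%E).
  rewrite -esumD; last 2 first.
  - by move=> x _; rewrite mule_ge0.
  - by move=> x _; rewrite mule_ge0.
  by apply: le_esum => x _; rewrite /F -!EFinM -EFinD lee_fin normcD_sq.
by apply: leeD; apply: esumZ_le.
Qed.

Lemma square_summable_submod : submod_closed square_summable.
Proof.
split.
  apply/asboolP; rewrite /sumsq esum1 ?ltry// => x _.
  by rewrite normc0 expr0n.
move=> a f g /asboolP fi /asboolP gi; apply/asboolP.
apply: (le_lt_trans (sumsqD _ _)); rewrite lte_add_pinfty//; last first.
  by rewrite lte_mul_pinfty.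
rewrite lte_mul_pinfty//; apply: le_lt_trans (sumsqZ _ _) _.
by rewrite lte_mul_pinfty// lee_fin sqr_ge0.
Qed.

HB.instance Definition _ :=
  GRing.isSubmodClosed.Build R[i] (T -> R[i]) square_summable
    square_summable_submod.

Record ell2 : predArgType :=
  Ell2 { ell2_fun :> T -> R[i]; _ : ell2_fun \in square_summable }.

HB.instance Definition _ := [isSub for ell2_fun].
HB.instance Definition _ := [Choice of ell2 by <:].
HB.instance Definition _ := [SubChoice_isSubLmodule of ell2 by <:].

Definition delta_fun (t : T) : T -> R[i] := fun x => (x == t)%:R.

Lemma delta_square_summable t : delta_fun t \in square_summable.
Proof.
apply/asboolP; rewrite /sumsq (esumID [set t])//; last first.
  by move=> x _; rewrite lee_fin sqr_ge0.
rewrite [X in (_ + X)%E]esum1 ?adde0; last first.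
  by move=> x [_ /eqP/negbTE]; rewrite /delta_fun => ->; rewrite normc0 expr0n.
by rewrite setTI esum_set1 ?ltry// lee_fin sqr_ge0.
Qed.

Definition delta (t : T) : ell2 := Ell2 (delta_square_summable t).

Definition ell2_norm (x : ell2) : R := Num.sqrt (fine (sumsq x)).

(* Only meaningful for absolutely summable families, as in [inner] below. *)
Definition rsum (f : T -> R) : R :=
  fine (\esum_(x in [set: T]) (Num.max (f x) 0)%:E)
  - fine (\esum_(x in [set: T]) (Num.max (- f x) 0)%:E).

Definition csum (f : T -> R[i]) : R[i] :=
  rsum (fun t => complex.Re (f t)) +i* rsum (fun t => complex.Im (f t)).

Definition inner (x y : ell2) : R[i] := csum (fun t => x t * (y t)^*).

Lemma ell2_norm_ge0 x : 0 <= ell2_norm x.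
Proof. exact: sqrtr_ge0. Qed.

Lemma ell2_sumsq_fin (x : ell2) : sumsq x \is a fin_num.
Proof.
case: x => f /= /asboolP fi.
by rewrite ge0_fin_numE ?sumsq_ge0.
Qed.

Lemma ell2_normZ (a : R[i]) x : ell2_norm (a *: x) <= normc a * ell2_norm x.
Proof.
have na0 : 0 <= normc a by case: a => b c; exact: sqrtr_ge0.
rewrite -[normc a]ger0_norm// -sqrtr_sqr -sqrtrM ?sqr_ge0// ler_wsqrtr//.
rewrite -lee_fin EFinM !fineK ?ell2_sumsq_fin//.
exact: (sumsqZ a x).
Qed.

Lemma ell2_normD x y : ell2_norm (x + y) <= 2 * (ell2_norm x + ell2_norm y).
Proof.
have X := ell2_sumsq_fin x; have Y := ell2_sumsq_fin y.
have : fine (sumsq (x + y)) <= 2 * fine (sumsq x) + 2 * fine (sumsq y).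
  rewrite -lee_fin EFinD !EFinM !fineK ?ell2_sumsq_fin//.
  exact: (sumsqD x y).
have sq z : fine (sumsq (z : ell2)) = ell2_norm z ^+ 2.
  by rewrite sqr_sqrtr// fine_ge0// sumsq_ge0.
rewrite !sq; have := ell2_norm_ge0 x; have := ell2_norm_ge0 y.
have := ell2_norm_ge0 (x + y).
move: (ell2_norm (x + y)) (ell2_norm x) (ell2_norm y) => c a b c0 b0 a0 h.
rewrite -ler_sqr ?nnegrE//; last by rewrite mulr_ge0// addr_ge0.
have : 0 <= a * b by rewrite mulr_ge0.
have := sqr_ge0 a; have := sqr_ge0 b; nra.
Qed.

End SquareSummable.

Section BoundedOperators.
Variables (R : realType) (T : choiceType).
Notation H := (ell2 R T).

Definition bounded_linear : {pred H -> H} :=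
  fun S => `[< linear S /\
    exists M : R, forall x, ell2_norm (S x) <= M * ell2_norm x >].

Lemma bounded_linear_submod : submod_closed bounded_linear.
Proof.
split.
  apply/asboolP; split; first by move=> a x y /=; rewrite scaler0 addr0.
  exists 0 => x; rewrite mul0r /ell2_norm.
  rewrite [X in fine X](_ : _ = 0%E) ?sqrtr0//.
  by apply: esum1 => t _; rewrite normc0 expr0n.
move=> a S S' /asboolP[lS [M SM]] /asboolP[lS' [M' SM']]; apply/asboolP; split.
  move=> b x y /=; rewrite !fctE lS lS' !scalerDr !scalerA mulrC.
  by rewrite addrACA.
exists (2 * (normc a * M + M')) => x.
apply: (le_trans (ell2_normD _ _)).
rewrite -mulrA ler_pM2l// mulrDl lerD//.
apply: (le_trans (ell2_normZ _ _)); rewrite -mulrA ler_wpM2l//.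
by case: (a) => b c; exact: sqrtr_ge0.
Qed.

HB.instance Definition _ :=
  GRing.isSubmodClosed.Build R[i] (H -> H) bounded_linear bounded_linear_submod.

Record bop : predArgType :=
  Bop { bop_fun :> H -> H; _ : bop_fun \in bounded_linear }.

HB.instance Definition _ := [isSub for bop_fun].
HB.instance Definition _ := [Choice of bop by <:].
HB.instance Definition _ := [SubChoice_isSubLmodule of bop by <:].

Lemma bop_id_subproof : (@id H) \in bounded_linear.
Proof. by apply/asboolP; split=> //; exists 1 => x; rewrite mul1r. Qed.

Lemma bop_comp_subproof (S S' : bop) : (S \o S') \in bounded_linear.
Proof.
case: S S' => [S /= /asboolP[lS [M SM]]] [S' /= /asboolP[lS' [M' SM']]].
apply/asboolP; split; first by move=> a x y /=; rewrite lS' lS.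
exists (`|M| * M') => x /=; apply: (le_trans (SM _)).
apply: (@le_trans _ _ (`|M| * ell2_norm (S' x))).
  by rewrite ler_wpM2r ?ell2_norm_ge0// ler_norm.
by rewrite -mulrA ler_wpM2l.
Qed.

Definition bop_id : bop := Bop bop_id_subproof.
Definition bop_comp (S S' : bop) : bop := Bop (bop_comp_subproof S S').

Lemma bopP (S S' : bop) : (forall x, S x = S' x) -> S = S'.
Proof. by move=> e; apply: val_inj; apply/funext. Qed.

Lemma bopD S S' x : (S + S' : bop) x = S x + S' x. Proof. by []. Qed.
Lemma bopZ a S x : (a *: S : bop) x = a *: S x. Proof. by []. Qed.
Lemma bop_linear (S : bop) : linear S.
Proof. by case: S => S /= /asboolP[]. Qed.
Lemma bop_linearD (S : bop) x y : S (x + y) = S x + S y.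
Proof. by rewrite -[x]scale1r bop_linear !scale1r. Qed.

End BoundedOperators.

Section OperatorAlgebras.
Variables (R : realType) (T : choiceType).
Notation H := (ell2 R T).
Notation BH := (bop R T).
Implicit Types (S : BH) (X M A B : set BH).

Definition op_norm S : R :=
  sup [set ell2_norm (S x) | x in [set x : H | ell2_norm x <= 1]].

Definition is_adjoint S S' : Prop :=
  forall x y : H, inner (S x) y = inner x (S' y).

Definition positive_op S : Prop := forall x : H, 0 <= inner (S x) x.

Definition commutant X : set BH :=
  [set S | forall S', X S' -> bop_comp S S' = bop_comp S' S].

(* Adjoints are unique and always exist, so the first clause is closure under
   adjoints. *)
Definition von_neumann_algebra M : Prop :=
  (forall S S', is_adjoint S S' -> M S -> M S') /\
  commutant (commutant M) = M.

Definition von_neumann_generated X : set BH := smallest von_neumann_algebra X.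

(* By Tomiyama's theorem positivity and the bimodule property follow from the
   other clauses when A and B are C*-algebras; they are listed as in the usual
   definition.  Only the values of E on A are relevant. *)
Definition conditional_expectation A B (E : BH -> BH) : Prop :=
  [/\ B `<=` A /\ (forall S, A S -> B (E S)),
      forall S, B S -> E S = S,
      forall (a : R[i]) S S', A S -> A S' -> E (a *: S + S') = a *: E S + E S',
      (forall S, A S -> op_norm (E S) <= op_norm S) /\
        (forall S, A S -> positive_op S -> positive_op (E S)) &
      forall S1 S S2, B S1 -> A S -> B S2 ->
        E (bop_comp (bop_comp S1 S) S2) = bop_comp (bop_comp S1 (E S)) S2].

End OperatorAlgebras.

Section CanonicalRepresentation.
Variables (R : realType) (G : groupType) (P : monoidType).
Variable theta : P -> G -> G.
Variables (Q : cstarAlgType R) (u : G -> Q) (s : P -> Q).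
Variable pi : Q -> bop R G.

Definition star_representation : Prop :=
  [/\ linear pi, pi 1 = bop_id R G,
      forall x y, pi (x * y) = bop_comp (pi x) (pi y) &
      forall x, is_adjoint (pi x) (pi (star x))].

Definition canonical_representation : Prop :=
  star_representation /\
  forall g p h, pi (u g * s p) (delta R h) = delta R (g * theta p h)%g.

(* C*(G), inside Q. *)
Definition group_cstar : set Q := cstar_generated (range u).

(* W*(G). *)
Definition group_von_neumann : set (bop R G) :=
  von_neumann_generated (pi @` group_cstar).

End CanonicalRepresentation.

(* Main.v *)
Require Import Defs.
From HB Require Import structures.
From mathcomp Require Import all_boot all_order all_algebra.
From mathcomp Require Import finmap.
From mathcomp Require Import all_classical all_reals all_analysis.
From mathcomp Require Import complex ring lra.

Set Implicit Arguments.
Unset Strict Implicit.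
Unset Printing Implicit Defensive.

Import Order.TTheory GRing.Theory Num.Theory.
Import numFieldNormedType.Exports.
Import ComplexField.Normc.

Local Open Scope classical_set_scope.
Local Open Scope ring_scope.
Local Notation "x %:C" := (real_complex _ x) : ring_scope.

(** The uniqueness part is an averaging argument.  Write [L_g = pi(u_g)] and [T
= V_p V_q^*] with [V_p = pi(s_p)].  The elements of [W*(G)] commute with all
[L_g], since [G] is abelian, and relation (I) gives [T = L_{theta_p(h)} T
L_{theta_q(h)}^*].  So the bimodule property of an expectation [E] yields [E T =
L_k (E T)] for every [k = Phi_{p,q}(h)].  If [p <> q], then some such [k] has
infinite order, and a square summable vector fixed by its translation vanishes
([translation_fixed_eq0]); hence [E T = 0] ([expectation_off_diagonal]).  If [p
= q], then [N_p] translates of [T] add up to [1] by relation (III), and [E] has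
the same value on each of them ([expectation_diagonal]).  The general monomial
follows from the bimodule property ([expectation_monomial]).  The
properties of [E] that enter are that it is linear, unital, a bimodule map for
the translations, and has values commuting with them.

For the existence of [E0] a map with these properties is constructed on all
bounded operators: the weak limit, along an ultrafilter, of the averages of [L_g
S L_g^*] over longer and longer boxes in the abelian group [G]
([folner_averages], [ultra_weak_limit], [averaging_expectation]).  By the first
part it satisfies the formula, so it sends monomials into [pi(C*(G))].  The
monomials span a dense subspace of [Q] by relations (I) and (II)
([monomial_dense]), and two contractive maps that agree on them agree on [pi(Q)]
([expectation_unique]), which gives both the remaining properties of [E0] and
the restriction statement.

Passing to closures requires that [pi] be contractive ([rep_contractive]), and
that [pi(C*(G))] be closed, that is, that the injective representation [pi] be
isometric ([rep_isometric]).  Both are derived, without spectral theory, from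
one fact: a self-adjoint element [1 - a] with [|a| <= 1] has a self-adjoint
square root that commutes with everything that commutes with [a]
([sqrt_one_sub]). *)

(** * Complex numbers and absolutely summable families *)

Section ComplexNumbers.
Variable R : realType.
Implicit Types a b : R[i].

Lemma ReD a b : complex.Re (a + b) = complex.Re a + complex.Re b.
Proof. by case: a b => [? ?] [? ?]. Qed.
Lemma ImD a b : complex.Im (a + b) = complex.Im a + complex.Im b.
Proof. by case: a b => [? ?] [? ?]. Qed.
Lemma ReB a b : complex.Re (a - b) = complex.Re a - complex.Re b.
Proof. by case: a b => [? ?] [? ?]. Qed.
Lemma ImB a b : complex.Im (a - b) = complex.Im a - complex.Im b.
Proof. by case: a b => [? ?] [? ?]. Qed.
Lemma ReM a b : complex.Re (a * b) =
  complex.Re a * complex.Re b - complex.Im a * complex.Im b.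
Proof. by case: a b => [? ?] [? ?]. Qed.
Lemma ImM a b : complex.Im (a * b) =
  complex.Re a * complex.Im b + complex.Im a * complex.Re b.
Proof. by case: a b => [? ?] [? ?]. Qed.
Lemma ReJ a : complex.Re a^* = complex.Re a.
Proof. by case: a. Qed.
Lemma ImJ a : complex.Im a^* = - complex.Im a.
Proof. by case: a. Qed.
Lemma Re_real (x : R) : complex.Re (x%:C) = x. Proof. by []. Qed.
Lemma complexP a b : complex.Re a = complex.Re b ->
  complex.Im a = complex.Im b -> a = b.
Proof. by case: a b => [? ?] [? ?] /= -> ->. Qed.

Lemma conjD a b : (a + b)^* = a^* + b^*.
Proof. by apply: complexP; rewrite !(ReJ, ImJ, ReD, ImD) ?opprD. Qed.
Lemma conjM a b : (a * b)^* = a^* * b^*.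
Proof. by apply: complexP; rewrite !(ReJ, ImJ, ReM, ImM); ring. Qed.
Lemma conjN a : (- a)^* = - a^*.
Proof. by case: a. Qed.

Lemma conjC_K a : a^*^* = a.
Proof. by case: a => x y; apply: complexP; rewrite //= opprK. Qed.
Lemma conj_real (x : R) : (x%:C)^* = x%:C.
Proof. by apply: complexP; rewrite //= oppr0. Qed.

Lemma normc_sq a : normc a ^+ 2 = complex.Re a ^+ 2 + complex.Im a ^+ 2.
Proof. by case: a => x y /=; rewrite sqr_sqrtr// addr_ge0// sqr_ge0. Qed.

Lemma normc_ge0 a : 0 <= normc a.
Proof. by case: a => x y; exact: sqrtr_ge0. Qed.

Lemma normc_real (x : R) : normc x%:C = `|x|.
Proof. by rewrite /= expr0n addr0 sqrtr_sqr. Qed.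

Lemma normcJ_eq a : normc a^* = normc a.
Proof. by case: a => x y /=; rewrite sqrrN. Qed.

Lemma Re_le_normc a : `|complex.Re a| <= normc a.
Proof.
rewrite -ler_sqr ?nnegrE ?normc_ge0// real_normK ?num_real//.
by rewrite normc_sq lerDl sqr_ge0.
Qed.

Lemma Im_le_normc a : `|complex.Im a| <= normc a.
Proof.
rewrite -ler_sqr ?nnegrE ?normc_ge0// real_normK ?num_real//.
by rewrite normc_sq lerDr sqr_ge0.
Qed.

Lemma mulcJ a : a * a^* = (normc a ^+ 2)%:C.
Proof.
by apply: complexP; rewrite ?ReM ?ImM ReJ ImJ ?normc_sq /=; ring.
Qed.

End ComplexNumbers.

Section AbsolutelySummable.
Variables (R : realType) (T : choiceType).
Implicit Types f g : T -> R.

Definition abs_summable f : Prop :=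
  (\esum_(t in [set: T]) (`|f t|)%:E < +oo)%E.

Lemma abs_summable_le f g : (forall t, `|f t| <= g t) ->
  abs_summable g -> abs_summable f.
Proof.
move=> fg; apply: le_lt_trans; apply: le_esum => t _.
by rewrite lee_fin (le_trans (fg t))// ler_norm.
Qed.

Lemma abs_summableD f g : abs_summable f -> abs_summable g ->
  abs_summable (fun t => f t + g t).
Proof.
move=> sf sg; apply: (@le_lt_trans _ _
  (\esum_(t in [set: T]) (`|f t|%:E + `|g t|%:E))%E).
  by apply: le_esum => t _; rewrite -EFinD lee_fin ler_normD.
by rewrite esumD ?lte_add_pinfty// => *; rewrite lee_fin.
Qed.

Lemma esumZ (c : R) (a : T -> R) : 0 <= c -> (forall t, 0 <= a t) ->
  (\esum_(t in [set: T]) (c * a t)%:E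
   = c%:E * \esum_(t in [set: T]) (a t)%:E)%E.
Proof.
move=> c0 a0; apply/eqP; rewrite eq_le; apply/andP; split.
  apply: (@le_trans _ _ (\esum_(t in [set: T]) (c%:E * (a t)%:E))%E).
    by apply: le_esum => t _; rewrite EFinM.
  by apply: esumZ_le => // t; rewrite lee_fin.
have /orP[/eqP<-|{}c0] : (0 == c) || (0 < c) by rewrite -le_eqVlt.
  by rewrite mul0e esum_ge0// => t _; rewrite mul0r.
rewrite muleC -lee_pdivlMr// muleC.
apply: (@le_trans _ _ (\esum_(t in [set: T]) (c^-1%:E * (c * a t)%:E))%E).
  by apply: le_esum => t _; rewrite -EFinM mulrA mulVf ?gt_eqF// mul1r.
apply: esumZ_le => [|t]; first by rewrite invr_ge0 ltW.
by rewrite lee_fin mulr_ge0// ltW.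
Qed.

Lemma abs_summableZ (c : R) f : abs_summable f ->
  abs_summable (fun t => c * f t).
Proof.
move=> sf; rewrite /abs_summable.
under eq_esum do rewrite normrM.
by rewrite esumZ// lte_mul_pinfty// lee_fin.
Qed.

Lemma fin_abs_summable f : (forall t, 0 <= f t) -> abs_summable f ->
  (\esum_(t in [set: T]) (f t)%:E)%E \is a fin_num.
Proof.
move=> f0; rewrite /abs_summable.
under eq_esum do rewrite ger0_norm//.
by move=> fi; rewrite ge0_fin_numE// esum_ge0// => t _; rewrite lee_fin.
Qed.

(** Cross-adding [a - b] with the positive and negative parts leaves two
nonnegative families with equal sums, so that the choice of the decomposition
does not matter.  The linearity of [rsum] follows. *)
Lemma rsum_diff (a b : T -> R) :
  (forall t, 0 <= a t) -> (forall t, 0 <= b t) ->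
  abs_summable a -> abs_summable b ->
  rsum (fun t => a t - b t) = fine (\esum_(t in [set: T]) (a t)%:E)
                              - fine (\esum_(t in [set: T]) (b t)%:E).
Proof.
move=> a0 b0 sa sb; rewrite /rsum.
set p := fun t => Num.max (a t - b t) 0.
set n := fun t => Num.max (- (a t - b t)) 0.
have p0 t : 0 <= p t by rewrite le_max lexx orbT.
have n0 t : 0 <= n t by rewrite le_max lexx orbT.
have sp : abs_summable p.
  apply: abs_summable_le sa => t; rewrite ger0_norm// ge_max a0 andbT.
  by rewrite gerBl.
have sn : abs_summable n.
  apply: abs_summable_le sb => t; rewrite ger0_norm// ge_max b0 andbT.
  by rewrite opprB gerBl.
have e : (\esum_(t in [set: T]) (p t)%:E + \esum_(t in [set: T]) (b t)%:E =
          \esum_(t in [set: T]) (n t)%:E + \esum_(t in [set: T]) (a t)%:E)%E.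
  rewrite -!esumD; try by move=> t _; rewrite lee_fin.
  apply: eq_esum => t _; rewrite -!EFinD /p /n; congr EFin.
  by rewrite /Num.max; do 2 case: ifPn; rewrite -?leNgt => *; lra.
apply/eqP; rewrite subr_eq addrAC eq_sym subr_eq addrC; apply/eqP.
have := congr1 fine e.
by rewrite !fineD ?fin_abs_summable//.
Qed.

Lemma rsum_split f : abs_summable f -> exists a b : T -> R,
  [/\ forall t, 0 <= a t, forall t, 0 <= b t,
      abs_summable a, abs_summable b & f = (fun t => a t - b t)].
Proof.
move=> sf; exists (fun t => Num.max (f t) 0), (fun t => Num.max (- f t) 0).
split.
- by move=> t; rewrite le_max lexx orbT.
- by move=> t; rewrite le_max lexx orbT.
- have h t : `|Num.max (f t) 0| <= `|f t|.
    rewrite ger0_norm ?le_max ?lexx ?orbT//.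
    by rewrite ge_max normr_ge0 ler_norm.
  by apply: abs_summable_le h _; rewrite /abs_summable;
    under eq_esum do rewrite normr_id.
- have h t : `|Num.max (- f t) 0| <= `|f t|.
    rewrite ger0_norm ?le_max ?lexx ?orbT//.
    by rewrite ge_max normr_ge0 -normrN ler_norm.
  by apply: abs_summable_le h _; rewrite /abs_summable;
    under eq_esum do rewrite normr_id.
- apply/funext => t; rewrite /Num.max.
  by do 2 case: ifPn; rewrite -?leNgt => *; lra.
Qed.

Lemma rsumD f g : abs_summable f -> abs_summable g ->
  rsum (fun t => f t + g t) = rsum f + rsum g.
Proof.
move=> /rsum_split[a [b [a0 b0 sa sb ->]]] /rsum_split[c [d [c0 d0 sc sd ->]]].
rewrite (_ : (fun _ => _) = (fun t => (a t + c t) - (b t + d t))); last first.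
  by apply/funext => t; lra.
rewrite !rsum_diff//; try by move=> t; rewrite addr_ge0.
- under eq_esum do rewrite EFinD.
  under [X in _ - fine X]eq_esum do rewrite EFinD.
  rewrite !esumD; try by move=> t _; rewrite lee_fin.
  by rewrite !fineD ?fin_abs_summable//; lra.
- exact: abs_summableD.
- exact: abs_summableD.
Qed.

Lemma rsumN f : rsum (fun t => - f t) = - rsum f.
Proof.
rewrite /rsum opprB; congr (_ - fine _).
by apply: eq_esum => t _; rewrite opprK.
Qed.

Lemma rsumZ (c : R) f : abs_summable f ->
  rsum (fun t => c * f t) = c * rsum f.
Proof.
suff pos d g : 0 <= d -> abs_summable g -> rsum (fun t => d * g t) = d * rsum g.
  move=> sf; case: (leP 0 c) => c0; first exact: pos.
  rewrite -[c]opprK mulNr -pos ?oppr_ge0 ?ltW// -rsumN.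
  by congr rsum; apply/funext => t; rewrite mulNr.
move=> d0 /rsum_split[a [b [a0 b0 sa sb ->]]].
under eq_fun do rewrite mulrBr.
rewrite !rsum_diff//; try by move=> t; rewrite mulr_ge0.
- by rewrite !esumZ// !fineM ?fin_abs_summable//= mulrBr.
- exact: abs_summableZ.
- exact: abs_summableZ.
Qed.

Lemma rsum_ge0 f : (forall t, 0 <= f t) ->
  rsum f = fine (\esum_(t in [set: T]) (f t)%:E).
Proof.
move=> f0; rewrite /rsum [X in _ - fine X]esum1 ?subr0; last first.
  by move=> t _; rewrite max_r// oppr_le0.
by congr fine; apply: eq_esum => t _; rewrite max_l.
Qed.

Lemma rsum_single f t : (forall t', t' != t -> f t' = 0) -> rsum f = f t.
Proof.
move=> f0.
suff pos g : (forall t', t' != t -> g t' = 0) ->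
    fine (\esum_(x in [set: T]) (Num.max (g x) 0)%:E) = Num.max (g t) 0.
  rewrite /rsum !pos => [|t' /f0 ->|//]; last by rewrite oppr0.
  by rewrite /Num.max; do 2 case: ifPn; rewrite -?leNgt => *; lra.
move=> g0; have m0 (x : R) : 0 <= Num.max x 0 by rewrite le_max lexx orbT.
rewrite (esumID [set t]) => [|x _]; last by rewrite lee_fin.
rewrite [X in (_ + X)%E]esum1 ?adde0 ?setTI ?esum_set1 ?lee_fin//.
by move=> x /= xt; rewrite g0 ?maxxx//; apply/eqP => xe; apply: xt.
Qed.

End AbsolutelySummable.

(** * The Hilbert space structure of l^2 *)

Section InnerProduct.
Variables (R : realType) (T : choiceType).
Notation H := (ell2 R T).
Implicit Types (f g : T -> R[i]) (x y z : H).

Definition csummable f : Prop := abs_summable (fun t => normc (f t)).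

Lemma csummable_Re f : csummable f -> abs_summable (fun t => complex.Re (f t)).
Proof. by apply: abs_summable_le => t; exact: Re_le_normc. Qed.

Lemma csummable_Im f : csummable f -> abs_summable (fun t => complex.Im (f t)).
Proof. by apply: abs_summable_le => t; exact: Im_le_normc. Qed.

Lemma csumD f g : csummable f -> csummable g ->
  csum (fun t => f t + g t) = csum f + csum g.
Proof.
move=> sf sg; apply: complexP; rewrite ?ReD ?ImD /=.
  rewrite -rsumD; [|exact: csummable_Re|exact: csummable_Re].
  by under eq_fun do rewrite ReD.
rewrite -rsumD; [|exact: csummable_Im|exact: csummable_Im].
by under eq_fun do rewrite ImD.
Qed.

Lemma csumZ (a : R[i]) f : csummable f ->
  csum (fun t => a * f t) = a * csum f.
Proof.
move=> sf; have sr := csummable_Re sf; have si := csummable_Im sf.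
apply: complexP; rewrite ?ReM ?ImM /=.
  under eq_fun do rewrite ReM.
  rewrite rsumD ?rsumN; last 2 first.
  - exact: abs_summableZ.
  - by under eq_fun do rewrite -mulNr; exact: abs_summableZ.
  by rewrite !rsumZ.
under eq_fun do rewrite ImM.
by rewrite rsumD ?rsumZ//; exact: abs_summableZ.
Qed.

Lemma csumJ f : csum (fun t => (f t)^*) = (csum f)^*.
Proof.
apply: complexP => /=; first by under eq_fun do rewrite ReJ.
by rewrite -rsumN; under eq_fun do rewrite ImJ.
Qed.

Lemma ell2D x y t : (x + y) t = x t + y t. Proof. by []. Qed.
Lemma ell2B x y t : (x - y) t = x t - y t. Proof. by []. Qed.
Lemma ell2Z a x t : (a *: x) t = a * x t. Proof. by []. Qed.
Lemma ell2_0 t : (0 : H) t = 0. Proof. by []. Qed.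

Lemma ell2_sum I (r : seq I) (F : I -> H) t :
  (\sum_(i <- r) F i) t = \sum_(i <- r) F i t.
Proof. by elim/big_rec2: _ => [//|i y z _ <-]; rewrite ell2D. Qed.

Lemma ell2P x y : (forall t, x t = y t) -> x = y.
Proof. by move=> e; apply: val_inj; apply/funext. Qed.

Lemma ell2_norm_sq x : ell2_norm x ^+ 2 = fine (sumsq x).
Proof. by rewrite sqr_sqrtr// fine_ge0// sumsq_ge0. Qed.

Lemma abs_summable_sq x : abs_summable (fun t => normc (x t) ^+ 2).
Proof.
rewrite /abs_summable; under eq_esum do rewrite ger0_norm ?sqr_ge0//.
by have := ell2_sumsq_fin x; rewrite ge0_fin_numE// sumsq_ge0.
Qed.

Lemma inner_summable x y : csummable (fun t => x t * (y t)^*).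
Proof.
apply: abs_summable_le (abs_summableD (abs_summable_sq x) (abs_summable_sq y)).
move=> t; rewrite ger0_norm ?normc_ge0// normcM normcJ_eq.
have := sqr_ge0 (normc (x t) - normc (y t)).
have := normc_ge0 (x t); have := normc_ge0 (y t).
move: (normc _) (normc _) => a b; nra.
Qed.

Lemma innerDl x y z : inner (x + y) z = inner x z + inner y z.
Proof.
rewrite /inner -csumD; [|exact: inner_summable|exact: inner_summable].
by under eq_fun do rewrite ell2D mulrDl.
Qed.

Lemma innerZl a x z : inner (a *: x) z = a * inner x z.
Proof.
rewrite /inner -csumZ; last exact: inner_summable.
by under eq_fun do rewrite ell2Z -mulrA.
Qed.

Lemma innerC x y : inner y x = (inner x y)^*.
Proof.
rewrite /inner -csumJ; congr csum; apply/funext => t.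
by rewrite conjM conjC_K mulrC.
Qed.

Lemma innerDr x y z : inner x (y + z) = inner x y + inner x z.
Proof. by rewrite innerC innerDl conjD -!innerC. Qed.

Lemma innerZr a x y : inner x (a *: y) = a^* * inner x y.
Proof. by rewrite innerC innerZl conjM -innerC. Qed.

Lemma innerNl x y : inner (- x) y = - inner x y.
Proof. by rewrite -scaleN1r innerZl mulN1r. Qed.

Lemma innerNr x y : inner x (- y) = - inner x y.
Proof. by rewrite innerC innerNl conjN -innerC. Qed.

Lemma innerBl x y z : inner (x - y) z = inner x z - inner y z.
Proof. by rewrite innerDl innerNl. Qed.

Lemma innerBr x y z : inner x (y - z) = inner x y - inner x z.
Proof. by rewrite innerDr innerNr. Qed.

Lemma inner0l y : inner 0 y = 0.
Proof. by rewrite -[X in inner X _](scale0r (0 : H)) innerZl mul0r. Qed.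

Lemma inner_norm x : inner x x = (ell2_norm x ^+ 2)%:C.
Proof.
rewrite /inner; apply: complexP => /=.
  rewrite ell2_norm_sq rsum_ge0 => [|t]; last by rewrite mulcJ /= sqr_ge0.
  by congr fine; apply: eq_esum => t _; rewrite mulcJ.
under eq_fun do rewrite mulcJ.
by rewrite rsum_ge0//= esum1.
Qed.

Lemma inner_suml I (r : seq I) (F : I -> H) y :
  inner (\sum_(i <- r) F i) y = \sum_(i <- r) inner (F i) y.
Proof.
by elim/big_rec2: _ => [|i a b _ <-]; rewrite ?inner0l// innerDl.
Qed.

Lemma inner_delta x t : inner x (delta R t) = x t.
Proof.
have e t' : x t' * ((delta R t) t')^* = if t' == t then x t else 0.
  rewrite /= /delta_fun; case: eqP => [->|_];
    first by rewrite -[1]/(1%:C) conj_real mulr1.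
  by rewrite (conj_real 0) mulr0.
rewrite /inner (_ : (fun _ => _) = fun t' => if t' == t then x t else 0).
  apply: complexP => /=.
    rewrite (@rsum_single _ _ _ t) ?eqxx// => t' /negbTE tt'.
    by rewrite tt'.
  rewrite (@rsum_single _ _ _ t) ?eqxx// => t' /negbTE tt'.
  by rewrite tt'.
by apply/funext => t'; exact: e.
Qed.

Lemma inner_inj x y : (forall z, inner x z = inner y z) -> x = y.
Proof. by move=> e; apply: ell2P => t; rewrite -!inner_delta e. Qed.

Lemma ell2_norm_eq0 x : ell2_norm x = 0 -> x = 0.
Proof.
move=> x0; apply: ell2P => t; rewrite ell2_0; apply: eq0_normc.
have : (((normc (x t) ^+ 2)%:E : \bar R) <= sumsq x)%E.
  apply: esum_ge; exists [set t]; first by split.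
  by rewrite fsbig_set1.
rewrite -[sumsq x]fineK ?ell2_sumsq_fin// lee_fin -ell2_norm_sq x0 expr0n/=.
by move=> h; apply/eqP; rewrite -sqrf_eq0 eq_le h sqr_ge0.
Qed.

Lemma ell2_normZ_eq (a : R[i]) x : ell2_norm (a *: x) = normc a * ell2_norm x.
Proof.
apply/eqP; rewrite -(@eqrXn2 _ 2)//; last 2 first.
- by rewrite ell2_norm_ge0.
- by rewrite mulr_ge0 ?normc_ge0 ?ell2_norm_ge0.
apply/eqP; have : inner (a *: x) (a *: x) = (normc a ^+ 2)%:C * inner x x.
  by rewrite innerZl innerZr mulrA mulcJ.
by rewrite !inner_norm -rmorphM/= => -[->]; rewrite exprMn.
Qed.

Lemma ell2_normN x : ell2_norm (- x) = ell2_norm x.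
Proof. by rewrite -scaleN1r ell2_normZ_eq normcN normc1 mul1r. Qed.

Lemma ell2_norm0 : @ell2_norm R T 0 = 0.
Proof. by rewrite -(@scale0r _ H 0) ell2_normZ_eq normc0 mul0r. Qed.

Lemma ell2_norm_delta (t : T) : ell2_norm (delta R t) = 1.
Proof.
apply/eqP; rewrite -(@eqrXn2 _ 2)//; last by rewrite ell2_norm_ge0.
have := inner_norm (delta R t).
by rewrite inner_delta /= /delta_fun eqxx expr1n => -[<-].
Qed.

Lemma cauchy_schwarz x y : normc (inner x y) <= ell2_norm x * ell2_norm y.
Proof.
have nx := ell2_norm_ge0 x; have ny := ell2_norm_ge0 y.
have [y0|y0] := eqVneq (ell2_norm y) 0.
  by rewrite (ell2_norm_eq0 y0) innerC inner0l (conj_real 0) normc0 mulr_ge0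
    ?ell2_norm_ge0.
rewrite -ler_sqr ?nnegrE ?normc_ge0 ?mulr_ge0//.
set c := inner x y; set N := ell2_norm y ^+ 2.
have N0 : 0 < N by rewrite exprn_gt0// lt_def y0.
(* The vector below is N times the component of x orthogonal to y. *)
pose w := N%:C *: x - c *: y.
have : inner w w = (N * (N * ell2_norm x ^+ 2 - normc c ^+ 2))%:C.
  rewrite /w innerBl !innerBr !innerZl !innerZr !inner_norm -/N.
  rewrite [inner y x]innerC -/c conj_real.
  rewrite (_ : N%:C * (c^* * c) = N%:C * (c * c^*)); last by ring.
  rewrite (_ : c * (N%:C * c^*) = N%:C * (c * c^*)); last by ring.
  rewrite (_ : c * (c^* * N%:C) = N%:C * (c * c^*)); last by ring.
  rewrite mulcJ subrr subr0 -!rmorphM/= -rmorphB/=; congr (_%:C); ring.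
rewrite inner_norm => -[e].
have : 0 <= N * (N * ell2_norm x ^+ 2 - normc c ^+ 2) by rewrite -e sqr_ge0.
by rewrite pmulr_rge0// subr_ge0 exprMn [leRHS]mulrC.
Qed.

Lemma ell2_norm_sqD x y : ell2_norm (x + y) ^+ 2 =
  ell2_norm x ^+ 2 + 2 * complex.Re (inner x y) + ell2_norm y ^+ 2.
Proof.
have := inner_norm (x + y).
rewrite innerDl !innerDr [inner y x]innerC (inner_norm x) (inner_norm y).
move: (inner x y) => a /(congr1 (@complex.Re R)).
by rewrite !ReD ReJ !Re_real => <-; lra.
Qed.

Lemma ell2_norm_triangle x y :
  ell2_norm (x + y) <= ell2_norm x + ell2_norm y.
Proof.
have nx := ell2_norm_ge0 x; have ny := ell2_norm_ge0 y.
rewrite -ler_sqr ?nnegrE ?addr_ge0 ?ell2_norm_ge0// ell2_norm_sqD.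
have := le_trans (ler_norm _) (le_trans (Re_le_normc _) (cauchy_schwarz x y)).
by move: (complex.Re _) => r h; nra.
Qed.

Lemma ell2_coord_le x t : normc (x t) <= ell2_norm x.
Proof.
by rewrite -inner_delta (le_trans (cauchy_schwarz _ _))// ell2_norm_delta mulr1.
Qed.

Lemma sumsq_le_fset f (M : R) :
  (forall F : {fset T}, \sum_(t <- F) normc (f t) ^+ 2 <= M) ->
  (sumsq f <= M%:E)%E.
Proof.
move=> h; apply: ge_ereal_sup => _ [A [finA _] <-].
by rewrite fsbig_finite// sumEFin lee_fin.
Qed.

Lemma sum_fset_le_norm x (F : {fset T}) :
  \sum_(t <- F) normc (x t) ^+ 2 <= ell2_norm x ^+ 2.
Proof.
rewrite ell2_norm_sq -lee_fin fineK ?ell2_sumsq_fin//.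
apply: esum_ge; exists [set` F]; first by split.
by rewrite fsbig_finite// set_fsetK sumEFin.
Qed.

Lemma sum_fset_gt_norm x (e : R) : 0 < e -> exists F : {fset T},
  ell2_norm x ^+ 2 - e < \sum_(t <- F) normc (x t) ^+ 2.
Proof.
move=> e0; have [_ [A [finA _] <-]] :=
  ub_ereal_sup_adherent e0 (ell2_sumsq_fin x).
rewrite fsbig_finite// sumEFin -[ereal_sup _]/(sumsq x).
rewrite -[sumsq x]fineK ?ell2_sumsq_fin// -EFinB lte_fin -ell2_norm_sq => h.
by exists (fset_set A).
Qed.

Definition finite_combination (F : {fset T}) f : H :=
  \sum_(t <- F) f t *: delta R t.

Lemma finite_combinationE (F : {fset T}) f t :
  finite_combination F f t = if t \in F then f t else 0.
Proof.
rewrite /finite_combination ell2_sum; case: ifPn => tF.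
  rewrite (big_rem t)//= big_seq big1 => [|t'].
    by rewrite addr0 -[LHS]/(f t * (t == t)%:R) eqxx mulr1.
  rewrite mem_rem_uniq ?fset_uniq// inE => /andP[/negbTE t't _].
  by rewrite -[LHS]/(f t' * (t == t')%:R) eq_sym t't mulr0.
rewrite big_seq big1// => t' t'F; rewrite -[LHS]/(f t' * (t == t')%:R).
by case: eqP => [tt'|]; rewrite ?mulr0//; rewrite tt' t'F in tF.
Qed.

Lemma inner_finite_combination (F : {fset T}) f y :
  inner y (finite_combination F f) = \sum_(t <- F) y t * (f t)^*.
Proof.
rewrite innerC inner_suml (big_morph _ (@conjD R) (conj_real 0)).
by apply: eq_bigr => t _; rewrite innerZl conjM -innerC inner_delta mulrC.
Qed.

Lemma norm_finite_combination (F : {fset T}) f :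
  ell2_norm (finite_combination F f) ^+ 2 = \sum_(t <- F) normc (f t) ^+ 2.
Proof.
set v := finite_combination F f.
have -> : ell2_norm v ^+ 2 = complex.Re (inner v v)
  by rewrite inner_norm Re_real.
rewrite {2}/v inner_finite_combination (big_morph _ (@ReD R) (erefl _)).
rewrite big_seq [RHS]big_seq; apply: eq_bigr => t tF.
by rewrite finite_combinationE tF mulcJ Re_real.
Qed.

Lemma norm_finite_combination_le (F : {fset T}) f :
  ell2_norm (finite_combination F f) <= \sum_(t <- F) normc (f t).
Proof.
apply: (big_ind2 (fun (v : H) (r : R) => ell2_norm v <= r)).
- by rewrite ell2_norm0.
- by move=> v r w r' vr wr'; rewrite (le_trans (ell2_norm_triangle _ _))// lerD.
- by move=> t _; rewrite ell2_normZ_eq ell2_norm_delta mulr1.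
Qed.

(** By Pythagoras, the distance of [x] to its restriction to [F] is the square
root of the part of the square sum that [F] misses. *)
Lemma ell2_dense x (e : R) : 0 < e ->
  exists F : {fset T}, ell2_norm (x - finite_combination F x) <= e.
Proof.
move=> e0; have e20 : 0 < e ^+ 2 by rewrite exprn_gt0.
have [F hF] := sum_fset_gt_norm x e20; exists F.
rewrite -ler_sqr ?nnegrE ?ell2_norm_ge0 ?ltW// .
set y := finite_combination F x.
have orth : inner (x - y) y = 0.
  rewrite inner_finite_combination big_seq big1// => t tF.
  by rewrite ell2B finite_combinationE tF subrr mul0r.
have ny : ell2_norm y ^+ 2 = _ := norm_finite_combination F x.
have := ell2_norm_sqD (x - y) y; rewrite orth subrK ny /=.
by move: hF; lra.
Qed.

End InnerProduct.

Local Notation "S \* S'" := (bop_comp S S') (at level 40, left associativity).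

(** * Bounded operators *)

Section BoundedOperators.
Variables (R : realType) (T : choiceType).
Notation H := (ell2 R T).
Notation BH := (bop R T).
Implicit Types (S : BH) (x y : H).

Lemma bopZ_arg S (a : R[i]) x : S (a *: x) = a *: S x.
Proof.
have S0 : S 0 = 0.
  by have := bop_linear S (-1) 0 0; rewrite scaler0 addr0 scaleN1r addNr.
by rewrite -[a *: x]addr0 bop_linear S0 addr0.
Qed.

Lemma bop0_arg S : S 0 = 0.
Proof. by have := bopZ_arg S 0 0; rewrite !scale0r. Qed.

Lemma bopN_arg S x : S (- x) = - S x.
Proof. by rewrite -scaleN1r bopZ_arg scaleN1r. Qed.

Lemma bopB_arg S x y : S (x - y) = S x - S y.
Proof. by rewrite bop_linearD bopN_arg. Qed.

Lemma bop_sum_arg S I (r : seq I) (F : I -> H) :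
  S (\sum_(i <- r) F i) = \sum_(i <- r) S (F i).
Proof.
by elim/big_rec2: _ => [|i a b _ <-]; rewrite ?bop0_arg// bop_linearD.
Qed.

Lemma bopN S x : (- S) x = - S x. Proof. by []. Qed.
Lemma bopB S S' x : (S - S') x = S x - S' x. Proof. by []. Qed.
Lemma bop0 x : (0 : BH) x = 0. Proof. by []. Qed.
Lemma bop_compE S S' x : (S \* S') x = S (S' x). Proof. by []. Qed.
Lemma bop_idE x : bop_id R T x = x. Proof. by []. Qed.

Lemma bop_sum I (r : seq I) (F : I -> BH) x :
  (\sum_(i <- r) F i) x = \sum_(i <- r) F i x.
Proof. by elim/big_rec2: _ => [//|i y S _ <-]; rewrite bopD. Qed.

Definition opbd S (M : R) : Prop := forall x,
  ell2_norm (S x) <= M * ell2_norm x.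

Lemma opbd_ge0 S : exists2 M : R, 0 <= M & opbd S M.
Proof.
case: S => S hS; have /asboolP[_ [M SM]] := hS; exists `|M| => // x.
by rewrite (le_trans (SM x))// ler_wpM2r ?ell2_norm_ge0// ler_norm.
Qed.

Lemma opbd_le S M M' : M <= M' -> opbd S M -> opbd S M'.
Proof. by move=> MM' h x; rewrite (le_trans (h x))// ler_wpM2r ?ell2_norm_ge0.
  Qed.

Lemma opbdD S S' M M' : opbd S M -> opbd S' M' -> opbd (S + S') (M + M').
Proof.
move=> h h' x; rewrite bopD (le_trans (ell2_norm_triangle _ _))//.
by rewrite mulrDl lerD.
Qed.

Lemma opbdN S M : opbd S M -> opbd (- S) M.
Proof. by move=> h x; rewrite bopN ell2_normN. Qed.

Lemma opbdB S S' M M' : opbd S M -> opbd S' M' -> opbd (S - S') (M + M').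
Proof. by move=> h h'; apply: opbdD => //; exact: opbdN. Qed.

Lemma opbdZ S M (a : R[i]) : opbd S M -> opbd (a *: S) (normc a * M).
Proof.
by move=> h x; rewrite bopZ ell2_normZ_eq -mulrA ler_wpM2l ?normc_ge0.
Qed.

Lemma opbd_sum I (r : seq I) (F : I -> BH) M :
  (forall i, opbd (F i) M) -> opbd (\sum_(i <- r) F i) ((size r)%:R * M).
Proof.
move=> h; elim: r => [|i r IH].
  by rewrite big_nil mul0r => x; rewrite bop0 ell2_norm0 mul0r.
by rewrite big_cons /= -addn1 natrD addrC mulrDl mul1r; exact: opbdD.
Qed.

Lemma opbd_op_norm S : opbd S (op_norm S).
Proof.
move=> x; have [M M0 SM] := opbd_ge0 S.
have [x0|x0] := eqVneq (ell2_norm x) 0.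
  by rewrite (ell2_norm_eq0 x0) bop0_arg ell2_norm0 mulr0.
have xp : 0 < ell2_norm x by rewrite lt_def x0 ell2_norm_ge0.
rewrite -ler_pdivrMr// mulrC.
have -> : (ell2_norm x)^-1 * ell2_norm (S x)
    = ell2_norm (S (((ell2_norm x)^-1)%:C *: x)).
  by rewrite bopZ_arg ell2_normZ_eq normc_real ger0_norm// invr_ge0 ltW.
apply: ub_le_sup; last first.
  exists (((ell2_norm x)^-1)%:C *: x) => //=.
  by rewrite ell2_normZ_eq normc_real ger0_norm ?mulVf// invr_ge0 ltW.
exists M => _ [y /= y1 <-]; rewrite (le_trans (SM y))//.
by rewrite -[leRHS]mulr1 ler_wpM2l.
Qed.

Lemma op_norm_le S M : 0 <= M -> opbd S M -> op_norm S <= M.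
Proof.
move=> M0 SM; apply: ge_sup.
  by exists (ell2_norm (S 0)), 0 => //=; rewrite ell2_norm0.
move=> _ [y /= y1 <-]; rewrite (le_trans (SM y))//.
by rewrite -[leRHS]mulr1 ler_wpM2l.
Qed.

Lemma op_norm_ge0 S : 0 <= op_norm S.
Proof.
have [M M0 SM] := opbd_ge0 S; apply: ub_le_sup; last first.
  by exists 0; rewrite /= ?bop0_arg ell2_norm0 ?ler01.
exists M => _ [y /= y1 <-]; rewrite (le_trans (SM y))//.
by rewrite -[leRHS]mulr1 ler_wpM2l.
Qed.

Lemma opbd_small_eq0 S : (forall e : R, 0 < e -> opbd S e) -> S = 0.
Proof.
move=> h; apply: bopP => x; rewrite bop0; apply: ell2_norm_eq0.
apply/eqP; rewrite eq_le ell2_norm_ge0 andbT; apply/ler_addgt0Pl => e e0.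
have x1 : 0 < ell2_norm x + 1 by rewrite ltr_wpDl ?ell2_norm_ge0.
have := h _ (divr_gt0 e0 x1) x; rewrite addr0 => /le_trans; apply.
by rewrite -mulrA ger_pMr// mulrC ler_pdivrMr// mul1r lerDl.
Qed.

End BoundedOperators.

(** * Norms and limits in C*-algebras *)

Section CStarAlgebraTheory.
Variables (R : realType) (A : cstarAlgType R).
Implicit Types (c d x y z l : A).

Lemma star0 : star (0 : A) = 0.
Proof. by apply: (addrI (star 0)); rewrite -starD !addr0. Qed.

Lemma starN x : star (- x) = - star x.
Proof. by apply: (addrI (star x)); rewrite -starD !subrr star0. Qed.

Lemma starB x y : star (x - y) = star x - star y.
Proof. by rewrite starD starN. Qed.

Lemma star1 : star (1 : A) = 1.
Proof. by rewrite -[star 1]mulr1 -{2}[1]starK -starM mulr1 starK. Qed.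

Lemma starZ_real (r : R) x : star (r%:C *: x) = r%:C *: star x.
Proof. by rewrite starZ conj_real. Qed.

Lemma cnorm0 : cnorm (0 : A) = 0.
Proof. by rewrite -(scale0r (0 : A)) cnormZ normc0 mul0r. Qed.

Lemma cnormN x : cnorm (- x) = cnorm x.
Proof. by rewrite -scaleN1r cnormZ normcN normc1 mul1r. Qed.

Lemma cnormB x y : cnorm (x - y) = cnorm (y - x).
Proof. by rewrite -cnormN opprB. Qed.

Lemma cnorm_ge0 x : 0 <= cnorm x.
Proof.
have := cnormD x (- x); rewrite subrr cnorm0 cnormN.
by rewrite -mulr2n pmulrn_lge0.
Qed.

Lemma cnorm_star x : cnorm (star x) = cnorm x.
Proof.
suff le z : cnorm z <= cnorm (star z).
  by apply/eqP; rewrite eq_le le andbT -{2}[x]starK le.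
have [z0|z0] := eqVneq (cnorm z) 0; first by rewrite z0 cnorm_ge0.
have zp : 0 < cnorm z by rewrite lt_def z0 cnorm_ge0.
by rewrite -(ler_pM2r zp) -expr2 -cstar_identity cnormM.
Qed.

Lemma cnorm_isometry_le1 x : star x * x = 1 -> cnorm x <= 1.
Proof.
move=> x1; have e : cnorm (1 : A) = cnorm (1 : A) ^+ 2.
  by rewrite -cstar_identity star1 mulr1.
have := cstar_identity x; rewrite x1 => h.
have := cnorm_ge0 x; have := cnorm_ge0 (1 : A).
move: e h; move: (cnorm _) (cnorm x) => u v e h v0 u0.
rewrite leNgt; apply/negP => v1; have u1 : 1 < u by clear x1; nra.
by clear x1; nra.
Qed.

(** Under these hypotheses [c + i d] is unitary, and [c] is its real part. *)
Lemma cnorm_cos_le1 c d : star c = c -> star d = d -> c * d = d * c ->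
  c * c + d * d = 1 -> cnorm c <= 1.
Proof.
move=> sc sd cd cd1; pose i : R[i] := 'i%C.
have ii : i * i = -1 by rewrite -expr2 sqr_i.
pose v := c + i *: d.
have iJ : i^* = - i by apply: complexP; rewrite /= ?oppr0.
have sv : star v = c - i *: d by rewrite /v starD starZ sc sd iJ scaleNr.
have vv : star v * v = 1.
  rewrite sv /v mulrBl !mulrDr -!scalerAl -!scalerAr scalerA ii scaleN1r.
  by rewrite cd opprB addrA addrAC addrK.
have v1 : cnorm v <= 1 by exact: cnorm_isometry_le1.
have -> : c = (2^-1 : R)%:C *: (v + star v).
  rewrite sv /v addrACA subrr addr0 scalerDr -scalerDl.
  rewrite (_ : _ + _ = 1) ?scale1r//.
  by apply: complexP; rewrite /= ?addr0//; lra.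
rewrite cnormZ normc_real ger0_norm ?invr_ge0// mulrC ler_pdivrMr// mul1r.
by rewrite (le_trans (cnormD _ _))// cnorm_star; lra.
Qed.

Definition clim (x : nat -> A) l : Prop :=
  cnorm (x n - l) @[n --> \oo] --> (0 : R).

Lemma clim_squeeze (x : nat -> A) l (b : nat -> R) :
  (forall n, cnorm (x n - l) <= b n) -> b n @[n --> \oo] --> (0 : R) ->
  clim x l.
Proof.
move=> xb b0; apply: (@squeeze_cvgr _ _ _ _ (fun=> 0) b).
- by near=> n; rewrite cnorm_ge0 xb.
- exact: cvg_cst.
- exact: b0.
Unshelve. all: by end_near. Qed.

Lemma clim_small (x : nat -> A) l : clim x l ->
  forall e : R, 0 < e -> exists N, forall n, (N <= n)%N -> cnorm (x n - l) < e.
Proof.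
move=> /cvgr0Pnorm_lt h e e0; have [N _ hN] := h e e0; exists N => n Nn.
by have := hN n Nn; rewrite ger0_norm ?cnorm_ge0.
Qed.

Lemma clim_unique (x : nat -> A) l l' : clim x l -> clim x l' -> l = l'.
Proof.
move=> xl xl'; apply/eqP; rewrite -subr_eq0; apply/eqP/cnorm_eq0.
apply/eqP; rewrite eq_le cnorm_ge0 andbT; apply/ler_addgt0Pl => e e0.
have e20 : 0 < e / 2 by rewrite divr_gt0.
have [N hN] := clim_small xl e20; have [N' hN'] := clim_small xl' e20.
have := hN (maxn N N') (leq_maxl _ _); have := hN' (maxn N N') (leq_maxr _ _).
set z := x _ => h' h; rewrite addr0 -(subrKA z l).
by rewrite (le_trans (cnormD _ _))// [cnorm (l - z)]cnormB; lra.
Qed.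

Lemma clim_cst l : clim (fun=> l) l.
Proof.
rewrite /clim; under eq_fun do rewrite subrr cnorm0.
exact: cvg_cst.
Qed.

Lemma climD (x y : nat -> A) l l' : clim x l -> clim y l' ->
  clim (fun n => x n + y n) (l + l').
Proof.
move=> xl yl; apply: (clim_squeeze (b := fun n =>
  cnorm (x n - l) + cnorm (y n - l'))).
  by move=> n; rewrite opprD addrACA cnormD.
by rewrite -(addr0 (0 : R)); exact: cvgD.
Qed.

Lemma climZ (x : nat -> A) l (a : R[i]) : clim x l ->
  clim (fun n => a *: x n) (a *: l).
Proof.
move=> xl; apply: (clim_squeeze (b := fun n => normc a * cnorm (x n - l))).
  by move=> n; rewrite -scalerBr cnormZ.
by rewrite -(mulr0 (normc a)); apply: cvgM => //; exact: cvg_cst.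
Qed.

Lemma clim_star (x : nat -> A) l : clim x l -> clim (fun n =>
  star (x n)) (star l).
Proof.
by rewrite /clim; under [in X in _ -> X]eq_fun do rewrite -starB cnorm_star.
Qed.

Lemma climM (x y : nat -> A) l l' : clim x l -> clim y l' ->
  clim (fun n => x n * y n) (l * l').
Proof.
move=> xl yl.
apply: (clim_squeeze (b := fun n => cnorm (x n - l) * cnorm (y n - l') +
   (cnorm (x n - l) * cnorm l' + cnorm l * cnorm (y n - l')))).
  move=> n; have -> : x n * y n - l * l' =
      (x n - l) * (y n - l') + ((x n - l) * l' + l * (y n - l')).
    by rewrite addrA -mulrDr subrK mulrBl mulrBr subrKA.
  rewrite (le_trans (cnormD _ _))// lerD ?cnormM//.
  by rewrite (le_trans (cnormD _ _))// lerD ?cnormM.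
rewrite (_ : 0 = 0 * 0 + (0 * cnorm l' + cnorm l * 0));
  last by rewrite !(mul0r, mulr0, addr0).
by apply: cvgD; [exact: cvgM|apply: cvgD; apply: cvgM => //; exact: cvg_cst].
Qed.

Lemma climS (x : nat -> A) l : clim x l -> clim (fun n => x n.+1) l.
Proof. by move=> xl; rewrite /clim (cvg_shiftS (fun n => cnorm (x n - l))). Qed.

Lemma clim_cnorm_le (x : nat -> A) l (M : R) : clim x l ->
  (forall n, cnorm (x n) <= M) -> cnorm l <= M.
Proof.
move=> xl xM; apply/ler_addgt0Pr => e e0.
have [N hN] := clim_small xl e0; have := hN N (leqnn N).
rewrite cnormB => h; rewrite -[l](subrK (x N)).
by rewrite (le_trans (cnormD _ _))// addrC lerD// ltW.
Qed.

End CStarAlgebraTheory.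

(** * Square roots by iteration *)

Section SquareRoot.
Variables (R : realType) (A : cstarAlgType R).
Implicit Types (a x y z : A).

Let half : R[i] := (2^-1 : R)%:C.

Lemma half_add x : half *: x + half *: x = x.
Proof.
rewrite -scalerDl (_ : _ + _ = 1) ?scale1r//.
by apply: complexP; rewrite /= ?addr0//; lra.
Qed.

(** The iteration of [sqrt_one_sub] for the scalar [a = 1]. *)
Fixpoint sqrt_bound (n : nat) : R :=
  if n is n'.+1 then (1 + sqrt_bound n' ^+ 2) / 2 else 0.

Lemma sqrt_bound_ge0 n : 0 <= sqrt_bound n.
Proof. by case: n => //= n; rewrite divr_ge0// addr_ge0// sqr_ge0. Qed.

Lemma sqrt_bound_le1 n : sqrt_bound n <= 1.
Proof.
elim: n => //= n IH; have := sqrt_bound_ge0 n.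
by move: (sqrt_bound n) IH => r r1 r0; nra.
Qed.

Lemma sqrt_bound_le n m : (n <= m)%N -> sqrt_bound n <= sqrt_bound m.
Proof.
move: n m; apply: (homo_leq (r := fun r s : R => r <= s)) => [//|r s t|n].
  exact: le_trans.
rewrite /=; have := sqr_ge0 (1 - sqrt_bound n).
by move: (sqrt_bound n) => r; nra.
Qed.

Lemma sqrt_bound_cauchy (e : R) : 0 < e -> exists N, forall m n,
  (N <= m)%N -> (N <= n)%N -> `|sqrt_bound m - sqrt_bound n| < e.
Proof.
move=> e0; pose S := range sqrt_bound.
have supS : has_sup S.
  split; first by exists (sqrt_bound 0), 0%N.
  by exists 1 => _ [n _ <-]; exact: sqrt_bound_le1.
have [_ [N _ <-] hN] := sup_adherent e0 supS.
exists N => m n Nm Nn.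
have ub k : sqrt_bound k <= sup S by apply: ub_le_sup; [exact: supS.2|exists k].
have := ub m; have := ub n; have := sqrt_bound_le Nm; have := sqrt_bound_le Nn.
by rewrite ltr_norml; move: hN => /= ? ? ? ? ?; apply/andP; split; lra.
Qed.

(** A solution of [y = (a + y^2) / 2] satisfies [(1 - y)^2 = 1 - a].  The
iteration of this fixed point equation from [0] has increments bounded by those
of [sqrt_bound], which converges; this reaches the boundary [|a| = 1], where the
map is no longer a strict contraction.  Every property listed passes from the
iterates to the limit. *)
Lemma sqrt_one_sub a : star a = a -> cnorm a <= 1 ->
  exists y, [/\ star y = y, cnorm y <= 1, (1 - y) * (1 - y) = 1 - a &
    forall z, z * a = a * z -> z * y = y * z].
Proof.
move=> sa a1; pose F y := half *: (a + y * y).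
pose Y n := iter n F 0.
have YS n : Y n.+1 = half *: (a + Y n * Y n) by [].
have nhalf : normc half = 2^-1 by rewrite normc_real ger0_norm// invr_ge0.
have Ybd n : cnorm (Y n) <= sqrt_bound n.
  elim: n => [|n IH]; first by rewrite cnorm0.
  rewrite YS cnormZ nhalf [sqrt_bound _]/= mulrC ler_wpM2r ?invr_ge0//.
  rewrite (le_trans (cnormD _ _))// lerD// (le_trans (cnormM _ _))//.
  by rewrite expr2 ler_pM ?cnorm_ge0.
have Yinc n : cnorm (Y n.+1 - Y n) <= sqrt_bound n.+1 - sqrt_bound n.
  elim: n => [|n IH].
    rewrite subr0 -[Y 1%N]/(half *: (a + 0 * 0)) mulr0 addr0 cnormZ nhalf /=.
    by rewrite expr0n /=; lra.
  rewrite [Y n.+2]YS {2}[Y n.+1]YS -scalerBr cnormZ nhalf opprD addrACA subrr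
    add0r.
  rewrite (_ : Y n.+1 * Y n.+1 - Y n * Y n =
    Y n.+1 * (Y n.+1 - Y n) + (Y n.+1 - Y n) * Y n); last first.
    by rewrite mulrBr mulrBl subrKA.
  have h1 := cnormM (Y n.+1) (Y n.+1 - Y n).
  have h2 := cnormM (Y n.+1 - Y n) (Y n).
  have h := le_trans (cnormD (Y n.+1 * (Y n.+1 - Y n)) ((Y n.+1 - Y n) * Y n))
              (lerD h1 h2).
  have d0 := cnorm_ge0 (Y n.+1 - Y n).
  have b1 := Ybd n.+1; have b0 := Ybd n.
  have c1 := cnorm_ge0 (Y n.+1); have c0 := cnorm_ge0 (Y n).
  have -> : sqrt_bound n.+2 - sqrt_bound n.+1 =
    2^-1 * (sqrt_bound n.+1 * (sqrt_bound n.+1 - sqrt_bound n)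
            + (sqrt_bound n.+1 - sqrt_bound n) * sqrt_bound n).
    have bS k : sqrt_bound k.+1 = (1 + sqrt_bound k ^+ 2) / 2 by [].
    by rewrite (bS n.+1) [X in _ - X = _]bS; field.
  rewrite ler_wpM2l ?invr_ge0// (le_trans h)// lerD//.
    by rewrite ler_pM.
  by rewrite ler_pM.
have Ydiff n k : cnorm (Y (n + k)%N - Y n) <= sqrt_bound (n + k) - sqrt_bound n.
  elim: k => [|k IH]; first by rewrite addn0 !subrr cnorm0.
  rewrite addnS -(subrKA (Y (n + k)%N)) (le_trans (cnormD _ _))//.
  by have := Yinc (n + k)%N; move: IH; lra.
have Ycauchy (e : R) : 0 < e -> exists N : nat, forall m n : nat,
    (N <= m)%N -> (N <= n)%N -> cnorm (Y m - Y n) < e.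
  move=> /sqrt_bound_cauchy[N hN]; exists N => m n Nm Nn.
  wlog nm : m n Nm Nn / (n <= m)%N.
    move=> h; have [/h->//|/ltnW mn] := leqP n m.
    by rewrite cnormB h.
  rewrite -(subnKC nm) (le_lt_trans (Ydiff _ _))// subnKC//.
  by rewrite (le_lt_trans (ler_norm _))// hN.
have [y Yy] := cnorm_complete Y Ycauchy; exists y.
have Ystar n : star (Y n) = Y n.
  elim: n => [|n IH]; first by rewrite star0.
  by rewrite YS starZ_real starD sa starM IH.
have yE : y = half *: (a + y * y).
  apply: (clim_unique (climS Yy)); apply: climZ; apply: climD.
    exact: clim_cst.
  exact: climM.
split.
- apply: (@clim_unique _ _ Y) => //.
  by have := clim_star Yy; under eq_fun do rewrite Ystar.
- by apply: (clim_cnorm_le Yy) => n;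
  rewrite (le_trans (Ybd n))// sqrt_bound_le1.
- have e : y + y = a + y * y by rewrite {1 2}yE half_add.
  rewrite mulrBl mul1r mulrBr mulr1 opprB addrA addrAC.
  by rewrite -[1 - y - y]addrA -opprD e opprD addrA subrK.
- move=> z za.
  have zY n : z * Y n = Y n * z.
    elim: n => [|n IH]; first by rewrite mulr0 mul0r.
    rewrite YS -scalerAr -scalerAl mulrDr mulrDl za; congr (_ *: (_ + _)).
    by rewrite mulrA IH -mulrA IH mulrA.
  apply: (@clim_unique _ _ (fun n => z * Y n));
    first exact: climM (clim_cst z) Yy.
  by under eq_fun do rewrite zY; exact: climM Yy (clim_cst z).
Qed.

(** This provides the absolute value [d^2] of [b] as the square of a
self-adjoint element, hence as something that every representation maps to a
positive operator.  It takes two square roots, the first one of [b^2 = 1 - (1 -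
b^2)]. That [1 - b^2] lies in the unit ball is seen by writing it as [c^2],
where [c] is the sine that goes with the cosine [b]. *)
Lemma abs_sqrt b : star b = b -> cnorm b <= 1 ->
  exists d : A, [/\ star d = d, (d * d) * (d * d) = b * b &
    forall z, z * b = b * z -> z * d = d * z].
Proof.
move=> sb b1.
have sbb : star (b * b) = b * b by rewrite starM sb.
have bb1 : cnorm (b * b) <= 1.
  by rewrite (le_trans (cnormM _ _))// mulr_ile1// cnorm_ge0.
have comm_bb z : z * b = b * z -> z * (b * b) = (b * b) * z.
  by move=> zb; rewrite mulrA zb -mulrA zb mulrA.
have [y [sy y1 yE yc]] := sqrt_one_sub sbb bb1.
have s1y : star (1 - y) = 1 - y by rewrite starB star1 sy.
have c1 : cnorm (1 - y) <= 1.
  apply: (@cnorm_cos_le1 _ _ _ b) => //; last by rewrite yE subrK.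
  by rewrite mulrBl mulrBr mul1r mulr1 yc// comm_bb.
have cc1 : cnorm (1 - b * b) <= 1.
  by rewrite -yE (le_trans (cnormM _ _))// mulr_ile1// cnorm_ge0.
have scc : star (1 - b * b) = 1 - b * b by rewrite starB star1 sbb.
have [w [sw w1 wE wc]] := sqrt_one_sub scc cc1.
have [v [sv v1 vE vc]] := sqrt_one_sub sw w1.
exists (1 - v); split.
- by rewrite starB star1 sv.
- by rewrite vE wE opprB addrC subrK.
- move=> z zb; rewrite mulrBl mulrBr mul1r mulr1 vc// wc//.
  by rewrite mulrBl mulrBr mul1r mulr1 comm_bb.
Qed.

End SquareRoot.

(** * Representations of C*-algebras: contractivity and isometry *)

Section StarRepresentations.
Variables (R : realType) (G : groupType) (Q : cstarAlgType R).
Variable pi : Q -> bop R G.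
Implicit Types (x y : Q) (k l : ell2 R G).

Hypothesis hpi : star_representation pi.

Lemma rep_linear (a : R[i]) x y : pi (a *: x + y) = a *: pi x + pi y.
Proof. by case: hpi => h *; exact: h. Qed.

Lemma rep1 : pi 1 = bop_id R G. Proof. by case: hpi. Qed.

Lemma repM x y : pi (x * y) = pi x \* pi y. Proof. by case: hpi. Qed.

Lemma repD x y : pi (x + y) = pi x + pi y.
Proof. by rewrite -[x]scale1r rep_linear !scale1r. Qed.

Lemma rep0 : pi 0 = 0.
Proof. by apply: (addrI (pi 0)); rewrite -repD !addr0. Qed.

Lemma repZ (a : R[i]) x : pi (a *: x) = a *: pi x.
Proof. by rewrite -[a *: x]addr0 rep_linear rep0 addr0. Qed.

Lemma repB x y : pi (x - y) = pi x - pi y.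
Proof. by rewrite repD -scaleN1r repZ scaleN1r. Qed.

Lemma rep_sum I (r : seq I) (F : I -> Q) :
  pi (\sum_(i <- r) F i) = \sum_(i <- r) pi (F i).
Proof. by elim/big_rec2: _ => [|i y S _ <-]; rewrite ?rep0// repD. Qed.

Lemma rep_adj x k l : inner (pi x k) l = inner k (pi (star x) l).
Proof. by case: hpi => _ _ _ h; exact: h. Qed.

Lemma rep_norm_sq x k :
  (ell2_norm (pi x k) ^+ 2)%:C = inner (pi (star x * x) k) k.
Proof. by rewrite repM bop_compE rep_adj starK inner_norm. Qed.

(** If [x] lies in the unit ball, then [1 - x* x = b* b] for some [b], so that
[|pi(x)k|^2 + |pi(b)k|^2 = |k|^2]. *)
Lemma rep_contractive x : opbd (pi x) (cnorm x).
Proof.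
suff unit z : cnorm z <= 1 -> opbd (pi z) 1.
  have [x0|x0] := eqVneq (cnorm x) 0.
    by move=> k; rewrite (cnorm_eq0 x x0) rep0 bop0 ell2_norm0 cnorm0 mul0r.
  have xp : 0 < cnorm x by rewrite lt_def x0 cnorm_ge0.
  have n1 : normc ((cnorm x)^-1)%:C = (cnorm x)^-1.
    by rewrite normc_real ger0_norm// invr_ge0 ltW.
  have := unit (((cnorm x)^-1)%:C *: x);
    rewrite cnormZ n1 mulVf// => /(_ (lexx _)).
  move=> h k; have := h k.
  by rewrite repZ bopZ ell2_normZ_eq n1 mul1r mulrC ler_pdivrMr// mulrC.
move=> z1 k; rewrite mul1r.
have szz : star (star z * z) = star z * z by rewrite starM starK.
have zz1 : cnorm (star z * z) <= 1.
  by rewrite cstar_identity expr_le1// cnorm_ge0.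
have [y [sy _ yE _]] := sqrt_one_sub szz zz1.
have sb : star (1 - y) = 1 - y by rewrite starB star1 sy.
have := rep_norm_sq (1 - y) k.
rewrite sb yE (repB 1 (star z * z)) rep1 bopB innerBl bop_idE -rep_norm_sq
  inner_norm.
rewrite -rmorphB => /(congr1 (@complex.Re R)); rewrite !Re_real => e.
rewrite -ler_sqr ?nnegrE ?ell2_norm_ge0// -subr_ge0 -e.
exact: sqr_ge0.
Qed.

Hypothesis pi_inj : injective pi.

(** Let [c = x* x] and let [b] be a multiple of [1 - c^2] by a positive scalar
that lies in the unit ball.  Since [pi(x)] is a contraction, [pi(b)] is
positive.  Take [d] with [d^4 = b^2] and let [a = d^2].  For [D = pi(a - b) k]
the nonnegative numbers [<pi(a) D, D>] and [<pi(b) D, D>] add up to zero,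
because [(a + b)(a - b) = 0]; hence [pi(d) D = 0] and [pi(a (a - b)) = 0].  By
injectivity [a (a - b) = 0], which together with [a^2 = b^2] gives [(a - b)^2 =
0] and [a = b].  So [1 - c^2] is a multiple of [d^2], and [c] is the cosine of a
unitary. *)
Lemma rep_isometric_unit x : opbd (pi x) 1 -> cnorm x <= 1.
Proof.
move=> x1.
have sx1 : opbd (pi (star x)) 1.
  move=> k; rewrite mul1r.
  have [z|z] := eqVneq (ell2_norm (pi (star x) k)) 0;
    first by rewrite z ell2_norm_ge0.
  have zp : 0 < ell2_norm (pi (star x) k) by rewrite lt_def z ell2_norm_ge0.
  rewrite -(ler_pM2r zp) -expr2.
  have := inner_norm (pi (star x) k); rewrite rep_adj starK =>
    /(congr1 (@normc R)).
  rewrite normc_real ger0_norm ?sqr_ge0// => <-.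
  rewrite (le_trans (cauchy_schwarz _ _))// ler_wpM2l ?ell2_norm_ge0//.
  by have := x1 (pi (star x) k); rewrite mul1r.
set c := star x * x.
have sc : star c = c by rewrite starM starK.
have c1 k : ell2_norm (pi c k) <= ell2_norm k.
  rewrite repM bop_compE; have := sx1 (pi x k); have := x1 k.
  by rewrite !mul1r => h h'; exact: le_trans h' h.
suff : cnorm c <= 1.
  by rewrite cstar_identity expr_le1// cnorm_ge0.
pose b := 1 - c * c.
have sb : star b = b by rewrite starB star1 starM sc.
have bpos k : 0 <= complex.Re (inner (pi b k) k).
  rewrite repB rep1 bopB bop_idE innerBl -{1}sc -rep_norm_sq inner_norm.
  by rewrite ReB !Re_real subr_ge0 ler_sqr ?nnegrE ?ell2_norm_ge0.
(* The factor r brings b into the unit ball; t undoes it at the end. *)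
pose r := (1 + cnorm b)^-1.
have r0 : 0 < r by rewrite invr_gt0 ltr_wpDr ?cnorm_ge0.
pose b' := r%:C *: b.
have sb' : star b' = b' by rewrite starZ_real sb.
have b'1 : cnorm b' <= 1.
  rewrite cnormZ normc_real (ger0_norm (ltW r0)) /r mulrC ler_pdivrMr ?mul1r
    ?lerDr//.
  by rewrite ltr_wpDr ?cnorm_ge0.
have [d [sd dd dc]] := abs_sqrt sb' b'1.
pose a := d * d.
have ab : a * b' = b' * a.
  have db : d * b' = b' * d by rewrite dc.
  by rewrite /a -mulrA db mulrA db mulrA.
have aab : a * (a - b') = 0.
  apply: pi_inj; rewrite rep0; apply: bopP => k.
  set D := pi (a - b') k.
  have e : inner (pi a D) D + inner (pi b' D) D = 0.
    rewrite -innerDl -bopD -repD /D -bop_compE -repM.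
    by rewrite mulrBr !mulrDl (dd : a * a = _) ab [_ + b' * a]addrC subrr rep0
      bop0 inner0l.
  have dD : ell2_norm (pi d D) ^+ 2 = complex.Re (inner (pi a D) D).
    by have /(congr1 (@complex.Re R)) := rep_norm_sq d D; rewrite sd Re_real.
  have b'D : 0 <= complex.Re (inner (pi b' D) D).
    rewrite repZ bopZ innerZl; move: (inner _ _) (bpos D) => w w0.
    by rewrite ReM /= mul0r subr0 mulr_ge0// ltW.
  have : pi d D = 0.
    apply: ell2_norm_eq0; apply/eqP; rewrite -sqrf_eq0 eq_le sqr_ge0 andbT dD.
    move: e b'D; move: (inner _ _) (inner _ _) => w w'.
    by move=> /(congr1 (@complex.Re R)); rewrite ReD /=; lra.
  by move=> h; rewrite repM bop_compE -/D /a repM bop_compE h bop0_arg bop0.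
have eab : a = b'.
  have sa : star a = a by rewrite starM sd.
  apply/eqP; rewrite -subr_eq0; apply/eqP/cnorm_eq0/eqP.
  rewrite -sqrf_eq0 -cstar_identity starB sa sb' mulrBl aab sub0r.
  suff -> : b' * (a - b') = 0 by rewrite oppr0 cnorm0.
  by rewrite mulrBr -ab -(dd : a * a = _) -mulrBr -opprB mulrN aab oppr0.
pose t := Num.sqrt r^-1.
have tr : t * t * r = 1.
  by rewrite -expr2 sqr_sqrtr ?mulVf ?gt_eqF// invr_ge0 ltW.
apply: (@cnorm_cos_le1 _ _ _ (t%:C *: d)) => //.
- by rewrite starZ_real sd.
- rewrite -scalerAr -scalerAl; congr (_ *: _).
  apply: dc; rewrite -scalerAr -scalerAl; congr (_ *: _).
  by rewrite mulrBr mulrBl mulr1 mul1r mulrA.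
- rewrite -scalerAr -scalerAl scalerA -/a eab scalerA -!rmorphM/= tr scale1r.
  by rewrite addrC subrK.
Qed.

Lemma rep_isometric x (M : R) : 0 <= M -> opbd (pi x) M -> cnorm x <= M.
Proof.
move=> M0 xM.
apply/ler_addgt0Pr => e e0; set N := M + e.
have N0 : 0 < N by rewrite ltr_wpDl.
have n1 : normc (N^-1)%:C = N^-1 by rewrite normc_real ger0_norm// invr_ge0 ltW.
have : cnorm ((N^-1)%:C *: x) <= 1.
  apply: rep_isometric_unit; rewrite repZ.
  apply: (opbd_le _ (opbdZ _ xM)); rewrite n1 mulrC ler_pdivrMr// mul1r.
  by rewrite lerDl ltW.
by rewrite cnormZ n1 mulrC ler_pdivrMr// mul1r.
Qed.

End StarRepresentations.

(** * Weak limits of operators along an ultrafilter *)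

Section UltrafilterLimits.
Variables (R : realType) (U : set_system nat).
Hypothesis ultraU : UltraFilter U.
Implicit Types (z : nat -> R[i]) (w : R[i]).

Let properU : ProperFilter U := @ultra_proper _ U ultraU.
#[local] Existing Instance properU.

Definition cvg_along z w : Prop :=
  forall e : R, 0 < e -> U [set n | normc (z n - w) < e].

Lemma normcD_le (a b : R[i]) : normc (a + b) <= normc a + normc b.
Proof. exact: le_normcD. Qed.

Lemma normcB_sym (a b : R[i]) : normc (a - b) = normc (b - a).
Proof. by rewrite -normcN opprB. Qed.

Lemma cvg_along_cst w : cvg_along (fun=> w) w.
Proof.
by move=> e e0; apply: filterS filterT => n _ /=; rewrite subrr normc0.
Qed.

Lemma cvg_alongD z z' w w' : cvg_along z w -> cvg_along z' w' ->
  cvg_along (fun n => z n + z' n) (w + w').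
Proof.
move=> zw zw' e e0; have e20 : 0 < e / 2 by rewrite divr_gt0.
apply: filterS (filterI (zw _ e20) (zw' _ e20)) => n /= [h h'].
by rewrite opprD addrACA (le_lt_trans (normcD_le _ _))//; lra.
Qed.

Lemma cvg_alongZ z w (a : R[i]) :
  cvg_along z w -> cvg_along (fun n => a * z n) (a * w).
Proof.
move=> zw e e0; have a1 : 0 < normc a + 1 by rewrite ltr_wpDl ?normc_ge0.
apply: filterS (zw _ (divr_gt0 e0 a1)) => n /=; rewrite -mulrBr normcM.
rewrite ltr_pdivlMr// mulrDr mulr1 mulrC.
by have := normc_ge0 (z n - w); lra.
Qed.

Lemma cvg_along_sum I (r : seq I) (z : I -> nat -> R[i]) (w : I -> R[i]) :
  (forall i, cvg_along (z i) (w i)) ->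
  cvg_along (fun n => \sum_(i <- r) z i n) (\sum_(i <- r) w i).
Proof.
move=> zw; elim: r => [|i r IH].
  by rewrite big_nil; under eq_fun do rewrite big_nil; exact: cvg_along_cst.
by rewrite big_cons; under eq_fun do rewrite big_cons; exact: cvg_alongD.
Qed.

Lemma cvg_along_close z z' w : cvg_along z w ->
  (forall e : R, 0 < e -> U [set n | normc (z' n - z n) < e]) -> cvg_along z' w.
Proof.
move=> zw zz' e e0; have e20 : 0 < e / 2 by rewrite divr_gt0.
apply: filterS (filterI (zw _ e20) (zz' _ e20)) => n /= [h h'].
by rewrite -(subrKA (z n)) (le_lt_trans (normcD_le _ _))//; lra.
Qed.

Lemma cvg_along_unique z w w' : cvg_along z w -> cvg_along z w' -> w = w'.
Proof.
move=> zw zw'; apply/eqP; rewrite -subr_eq0; apply/eqP/eq0_normc/eqP.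
rewrite eq_le normc_ge0 andbT; apply/ler_addgt0Pl => e e0; rewrite addr0.
have e20 : 0 < e / 2 by rewrite divr_gt0.
have [n /= [h h']] := filter_ex (filterI (zw _ e20) (zw' _ e20)).
rewrite -(subrKA (z n)) (le_trans (normcD_le _ _))// normcB_sym.
by move: h h'; lra.
Qed.

Lemma cvg_along_ge0 z w : cvg_along z w -> (forall n, 0 <= z n) -> 0 <= w.
Proof.
move=> zw z0; rewrite lecE /=.
have close (e : R) : 0 < e -> - e <= complex.Re w /\ `|complex.Im w| <= e.
  move=> /zw /filter_ex[n /=] /ltW h.
  have := z0 n; rewrite lecE /= => /andP[/eqP i0 r0].
  have := le_trans (Re_le_normc _) h; rewrite ReB.
  have := le_trans (Im_le_normc _) h; rewrite ImB i0 sub0r normrN => ->.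
  by rewrite ler_norml => /andP[_]; split=> //; lra.
apply/andP; split.
  rewrite -normr_eq0 eq_le normr_ge0 andbT.
  by apply/ler_addgt0Pl => e e0; rewrite addr0; case: (close e e0).
by apply/ler_addgt0Pl => e e0; have [] := close e e0; lra.
Qed.

Lemma ultra_real_cvg (r : nat -> R) (M : R) : (forall n, `|r n| <= M) ->
  exists l, forall e : R, 0 < e -> U [set n | `|r n - l| < e].
Proof.
move=> rM; pose S := [set a : R | U [set n | a <= r n]].
have supS : has_sup S.
  split.
    exists (- M); apply: filterS filterT => n _ /=.
    by have := rM n; rewrite ler_norml => /andP[].
  exists M => a /filter_ex[n /= /le_trans]; apply.
  by rewrite (le_trans (ler_norm _)).
exists (sup S) => e e0.
have [a Sa ha] := sup_adherent e0 supS.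
have hb : U (~` [set n | sup S + e / 2 <= r n]).
  have [h|//] := in_ultra_setVsetC [set n | sup S + e / 2 <= r n] ultraU.
  have : sup S + e / 2 <= sup S by apply: ub_le_sup; [exact: supS.2|].
  by lra.
apply: filterS (filterI Sa hb) => n /= [h /negP]; rewrite -ltNge => h'.
by rewrite ltr_norml; apply/andP; split; lra.
Qed.

Lemma ultra_cvg_along z (M : R) : (forall n, normc (z n) <= M) ->
  exists w, cvg_along z w.
Proof.
move=> zM.
have [a ha] := ultra_real_cvg (fun n => le_trans (Re_le_normc (z n)) (zM n)).
have [b hb] := ultra_real_cvg (fun n => le_trans (Im_le_normc (z n)) (zM n)).
exists (a +i* b)%C => e e0; have e20 : 0 < e / 2 by rewrite divr_gt0.
apply: filterS (filterI (ha _ e20) (hb _ e20)) => n /= [].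
case: (z n) => x y /= h h'.
rewrite -(ltr_sqr (_ : _ \is Num.nneg)) ?nnegrE ?sqrtr_ge0 ?ltW// sqr_sqrtr
  ?addr_ge0 ?sqr_ge0//.
rewrite -(real_normK (num_real (x - a))) -(real_normK (num_real (y - b))).
by have := normr_ge0 (x - a); have := normr_ge0 (y - b); nra.
Qed.

Variable T : choiceType.
Notation H := (ell2 R T).

Lemma ultra_all (I : eqType) (r : seq I) (D : I -> set nat) :
  (forall i, U (D i)) -> U [set n | forall i, i \in r -> D i n].
Proof.
move=> UD; elim: r => [|i r IH]; first by apply: filterS filterT.
apply: filterS (filterI (UD i) IH) => n /= [Di Dr] j.
by rewrite inE => /predU1P[->|/Dr].
Qed.

Lemma cvg_along_sum_normc (r : seq T) (v : nat -> H) (f : T -> R[i]) (e : R) :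
  (forall t, cvg_along (fun n => v n t) (f t)) -> 0 < e ->
  U [set n | \sum_(t <- r) normc (v n t - f t) <= e].
Proof.
move=> vf e0; have s0 : 0 < ((size r).+1%:R : R) by rewrite ltr0n.
have := ultra_all r (fun t => vf t _ (divr_gt0 e0 s0)).
apply: filterS => n /= h.
apply: (@le_trans _ _ (\sum_(t <- r) e / (size r).+1%:R)).
  by rewrite big_seq [leRHS]big_seq; apply: ler_sum => t /h /ltW.
rewrite big_const_seq count_predT iter_addr addr0 -[_ *+ _]mulr_natl mulrCA.
by rewrite ger_pMr// ler_pdivrMr// mul1r ler_nat.
Qed.

Lemma cvg_along_coord_norm (v : nat -> H) (f : T -> R[i]) (K : R) :
  (forall n, ell2_norm (v n) <= K) ->
  (forall t, cvg_along (fun n => v n t) (f t)) ->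
  (sumsq f <= (K ^+ 2)%:E)%E.
Proof.
move=> vK vf; apply: sumsq_le_fset => F.
have K0 : 0 <= K := le_trans (ell2_norm_ge0 _) (vK 0%N).
rewrite -norm_finite_combination ler_sqr ?nnegrE ?ell2_norm_ge0//.
apply/ler_addgt0Pr => e e0.
have [n /= hn] := filter_ex (cvg_along_sum_normc F vf e0).
have -> : finite_combination F f =
    finite_combination F (v n) + finite_combination F (fun t => f t - v n t).
  apply: ell2P => t; rewrite ell2D !finite_combinationE.
  by case: ifP => _; rewrite ?addr0// addrC subrK.
rewrite (le_trans (ell2_norm_triangle _ _))// lerD//.
  apply: le_trans (vK n); rewrite -ler_sqr ?nnegrE ?ell2_norm_ge0//.
  by rewrite norm_finite_combination sum_fset_le_norm.
rewrite (le_trans (norm_finite_combination_le _ _))// (le_trans _ hn)//.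
by apply: ler_sum => t _; rewrite normcB_sym.
Qed.

Lemma cvg_along_coord_norm_le (v : nat -> H) (w : H) (K : R) :
  (forall n, ell2_norm (v n) <= K) ->
  (forall t, cvg_along (fun n => v n t) (w t)) ->
  ell2_norm w <= K.
Proof.
move=> vK vw; have K0 : 0 <= K := le_trans (ell2_norm_ge0 _) (vK 0%N).
rewrite -ler_sqr ?nnegrE ?ell2_norm_ge0// ell2_norm_sq -lee_fin fineK
  ?ell2_sumsq_fin//.
exact: cvg_along_coord_norm vK vw.
Qed.

(** Replacing [y] by a finitely supported vector changes all the inner products
by little, uniformly in [n], and for such [y] only finitely many coordinates
matter. *)
Lemma cvg_along_inner (v : nat -> H) (w y : H) (K : R) :
  (forall n, ell2_norm (v n) <= K) ->
  (forall t, cvg_along (fun n => v n t) (w t)) ->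
  cvg_along (fun n => inner (v n) y) (inner w y).
Proof.
move=> vK vw e e0; have K0 : 0 <= K := le_trans (ell2_norm_ge0 _) (vK 0%N).
have wK := cvg_along_coord_norm_le vK vw.
have K1 : 0 < 4 * (K + 1) by lra.
have [F hF] := ell2_dense y (divr_gt0 e0 K1).
set yF := finite_combination F y in hF.
have tail (x : H) : ell2_norm x <= K -> normc (inner x (y - yF)) <= e / 4.
  move=> xK; rewrite (le_trans (cauchy_schwarz _ _))//.
  rewrite (@le_trans _ _ ((K + 1) * (e / (4 * (K + 1)))))//.
    by rewrite ler_pM ?ell2_norm_ge0//; lra.
  by rewrite le_eqVlt; apply/orP; left; apply/eqP; field; apply/eqP; lra.
have cF : cvg_along (fun n => inner (v n) yF) (inner w yF).
  rewrite inner_finite_combination; under eq_fun do rewrite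
    inner_finite_combination.
  apply: cvg_along_sum => t; rewrite mulrC; under eq_fun do rewrite mulrC.
  exact: cvg_alongZ.
have e20 : 0 < e / 2 by rewrite divr_gt0.
apply: filterS (cF _ e20) => n hn.
change (is_true (normc (inner (v n) y - inner w y) < e)).
change (is_true (normc (inner (v n) yF - inner w yF) < e / 2)) in hn.
rewrite [X in normc X](_ : _ = (inner (v n) yF - inner w yF)
    + (inner (v n) (y - yF) - inner w (y - yF))); last by rewrite !innerBr;
      ring.
rewrite (le_lt_trans (normcD_le _ _))//.
have := normcD_le (inner (v n) (y - yF)) (- inner w (y - yF)); rewrite normcN.
by have := tail _ (vK n); have := tail _ wK; lra.
Qed.

(** The limit is taken coordinate by coordinate, which needs no choice of a
subsequence; the uniform bound makes the resulting families square summable. *)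
Lemma ultra_weak_limit (S : nat -> bop R T) (M : R) : 0 <= M ->
  (forall n, opbd (S n) M) ->
  exists2 L : bop R T, opbd L M &
    forall x t, cvg_along (fun n => S n x t) (L x t).
Proof.
move=> M0 SM.
have bd x n : ell2_norm (S n x) <= M * ell2_norm x by exact: SM.
have ex (xt : H * T) : exists w, cvg_along (fun n => S n xt.1 xt.2) w.
  by apply: ultra_cvg_along => n; exact: le_trans (ell2_coord_le _ _) (bd xt.1
    n).
have [f hf] := choice ex.
have fx x : (fun t => f (x, t)) \in @square_summable R T.
  apply/asboolP; apply: le_lt_trans (ltry ((M * ell2_norm x) ^+ 2)).
  by apply: cvg_along_coord_norm (bd x) _ => t; exact: (hf (x, t)).
pose Lf x : H := Ell2 (fx x).
have LfE x t : cvg_along (fun n => S n x t) (Lf x t) by exact: (hf (x, t)).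
have Lbd x : ell2_norm (Lf x) <= M * ell2_norm x.
  exact: cvg_along_coord_norm_le (bd x) (LfE x).
have Llin : linear Lf.
  move=> a x y; apply: ell2P => t.
  apply: (cvg_along_unique (LfE _ t)).
  under eq_fun do rewrite bop_linear ell2D ell2Z.
  rewrite ell2D ell2Z; apply: cvg_alongD (LfE y t); exact: cvg_alongZ.
have Lbop : Lf \in @bounded_linear R T by apply/asboolP; split=> //; exists M.
by exists (Bop Lbop).
Qed.

End UltrafilterLimits.

(** * Averaging over an abelian group *)

Section Averaging.
Variables (R : realType) (G : groupType) (L : G -> bop R G).
Notation BH := (bop R G).
Implicit Types (S A : BH) (g h k t : G) (l : seq G).

Hypothesis abelianG : forall g h : G, (g * h = h * g)%g.
Hypothesis translationE : forall g x t, L g x t = x (g^-1 * t)%g.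
Hypothesis translation_adj : forall g, is_adjoint (L g) (L g^-1%g).
Hypothesis translation_opbd : forall g, opbd (L g) 1.

Lemma translation1 : L 1%g = bop_id R G.
Proof. by apply: bopP => x; apply: ell2P => t;
  rewrite translationE invg1 mul1g. Qed.

Lemma translationM g h : L (g * h)%g = L g \* L h.
Proof.
apply: bopP => x; apply: ell2P => t; rewrite bop_compE !translationE.
by rewrite invgM mulgA.
Qed.

Lemma translationK g x : L g^-1%g (L g x) = x.
Proof. by rewrite -bop_compE -translationM mulVg translation1. Qed.

Lemma translationVK g x : L g (L g^-1%g x) = x.
Proof. by rewrite -bop_compE -translationM mulgV translation1. Qed.

Definition invariant_op S : Prop := forall g, L g \* S = S \* L g.

Lemma translation_invariant g : invariant_op (L g).
Proof. by move=> h; rewrite -!translationM abelianG. Qed.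

Definition conj_op g S : BH := L g \* S \* L g^-1%g.

Lemma conj_opE g S x : conj_op g S x = L g (S (L g^-1%g x)). Proof. by []. Qed.

Lemma conj_op_linear g (a : R[i]) S S' :
  conj_op g (a *: S + S') = a *: conj_op g S + conj_op g S'.
Proof.
by apply: bopP => x; rewrite bopD bopZ !conj_opE bopD bopZ bop_linearD bopZ_arg.
Qed.

Lemma conj_op0 g : conj_op g 0 = 0.
Proof. by apply: bopP => x; rewrite conj_opE bop0 bop0_arg. Qed.

Lemma conj_opB g S S' : conj_op g (S - S') = conj_op g S - conj_op g S'.
Proof. by apply: bopP => x; rewrite bopB !conj_opE bopB bopB_arg. Qed.

Lemma conj_opZ g (a : R[i]) S : conj_op g (a *: S) = a *: conj_op g S.
Proof. by rewrite -[a *: S]addr0 conj_op_linear conj_op0 addr0. Qed.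

Lemma conj_op_sum g I (r : seq I) (F : I -> BH) :
  conj_op g (\sum_(i <- r) F i) = \sum_(i <- r) conj_op g (F i).
Proof.
apply: bopP => x; rewrite conj_opE !bop_sum bop_sum_arg.
by apply: eq_bigr => i _; rewrite conj_opE.
Qed.

Lemma conj_opM g h S : conj_op (g * h)%g S = conj_op g (conj_op h S).
Proof.
apply: bopP => x; rewrite !conj_opE invgM !translationM !bop_compE.
by congr (L g (L h (S _))); rewrite -!bop_compE -!translationM abelianG.
Qed.

Lemma conj_opC g h S : conj_op g (conj_op h S) = conj_op h (conj_op g S).
Proof. by rewrite -!conj_opM abelianG. Qed.

Lemma conj_op_opbd g S (M : R) : opbd S M -> opbd (conj_op g S) M.
Proof.
move=> SM x; rewrite conj_opE.
have h1 := translation_opbd g (S (L g^-1%g x)).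
have h2 := translation_opbd g^-1%g x.
have h3 := translation_opbd g (L g^-1%g x).
rewrite translationVK in h3.
have e : ell2_norm (L g^-1%g x) = ell2_norm x.
  by apply/eqP; rewrite eq_le; move: h2 h3; rewrite !mul1r => -> ->.
by rewrite (le_trans h1)// mul1r (le_trans (SM _))// e.
Qed.

Definition average l S : BH :=
  ((size l)%:R^-1 : R)%:C *: \sum_(g <- l) conj_op g S.

Lemma average_opbd l S (M : R) : (0 < size l)%N -> opbd S M ->
  opbd (average l S) M.
Proof.
move=> l0 SM.
have s0 : 0 < ((size l)%:R : R) by rewrite ltr0n.
have := opbdZ ((size l)%:R^-1 : R)%:C (opbd_sum l (fun g => conj_op_opbd g SM)).
by rewrite normc_real ger0_norm ?invr_ge0 ?ltW// mulKf ?gt_eqF.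
Qed.

Lemma average_linear l (a : R[i]) S S' :
  average l (a *: S + S') = a *: average l S + average l S'.
Proof.
rewrite /average (eq_bigr _ (fun g _ => conj_op_linear g a S S')) big_split /=.
by rewrite -scaler_sumr scalerDr !scalerA mulrC.
Qed.

Lemma mean_cst l S : (0 < size l)%N ->
  ((size l)%:R^-1 : R)%:C *: \sum_(g <- l) S = S.
Proof.
move=> l0; rewrite scaler_sumr -scaler_suml big_const_seq count_predT iter_addr
  addr0.
by rewrite -rmorphMn -mulr_natr mulVf ?scale1r// pnatr_eq0 -lt0n.
Qed.

Lemma real_natV n : ((n%:R^-1 : R)%:C) = n%:R^-1 :> R[i].
Proof. by rewrite fmorphV rmorph_nat. Qed.

Lemma average_invariant l S : (0 < size l)%N -> invariant_op S ->
  average l S = S.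
Proof.
move=> l0 iS; rewrite /average.
rewrite (eq_bigr (fun=> S)) => [|g _]; first exact: mean_cst.
by rewrite /conj_op iS; apply: bopP => x; rewrite !bop_compE translationVK.
Qed.

Lemma average_bimodule l S1 S S2 : invariant_op S1 -> invariant_op S2 ->
  average l (S1 \* S \* S2) = S1 \* average l S \* S2.
Proof.
move=> i1 i2; apply: bopP => x; rewrite !bop_compE !bopZ bopZ_arg !bop_sum
  bop_sum_arg.
congr (_ *: _); apply: eq_bigr => g _; rewrite !conj_opE !bop_compE.
by rewrite -[S2 _]bop_compE -i2 bop_compE -[L g (S1 _)]bop_compE i1 bop_compE.
Qed.

Lemma average_positive l S : positive_op S -> positive_op (average l S).
Proof.
move=> S0 x; rewrite bopZ innerZl bop_sum inner_suml.
apply: mulr_ge0; first by rewrite lecE /= eqxx invr_ge0 ler0n.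
apply: sumr_ge0 => g _; rewrite conj_opE translation_adj; exact: S0.
Qed.

(** Averaging over a long orbit segment [1, g, ..., g^N] makes any operator
almost invariant under [g] by telescoping, and keeps almost invariance under
the other elements because the group is abelian. *)
Lemma folner_averages (gs : seq G) N : exists2 l, (0 < size l)%N &
  forall g S (M : R), g \in gs -> opbd S M ->
    opbd (conj_op g (average l S) - average l S) ((N.+1%:R)^-1 * (M + M)).
Proof.
elim: gs => [|g0 gs [l l0 IH]]; first by exists [:: 1%g].
pose l' := [seq (g0 ^+ i * h)%g | i <- iota 0 N.+1, h <- l].
have sl' : size l' = (N.+1 * size l)%N by rewrite size_allpairs size_iota.
have l'E S : average l' S =
    ((N.+1%:R)^-1 : R)%:C *: \sum_(0 <= i < N.+1) conj_op (g0 ^+ i)%g (average l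
      S).
  rewrite /average sl' natrM invfM rmorphM -scalerA; congr (_ *: _).
  rewrite big_allpairs_dep /= scaler_sumr /index_iota subn0.
  apply: eq_bigr => i _; rewrite conj_opZ conj_op_sum; congr (_ *: _).
  by apply: eq_bigr => h _; rewrite conj_opM.
have nN : normc ((N.+1%:R)^-1 : R)%:C = (N.+1%:R)^-1.
  by rewrite normc_real ger0_norm.
exists l'; first by rewrite sl' muln_gt0.
move=> g S M; rewrite inE => gin SM; rewrite l'E conj_opZ -scalerBr.
rewrite conj_op_sum -sumrB -[X in X * (M + M)]nN; apply: opbdZ.
have AM := average_opbd l0 SM; set A := average l S in AM *.
case/predU1P: gin => [->|gin].
  under eq_bigr do rewrite -conj_opM -expgS.
  rewrite telescope_sumr//.
  by apply: opbdB; exact: conj_op_opbd.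
under eq_bigr do rewrite conj_opC -conj_opB.
have -> : M + M = N.+1%:R * ((N.+1%:R)^-1 * (M + M)) by rewrite mulVKf.
have := opbd_sum (index_iota 0 N.+1)
  (fun i => conj_op_opbd (g0 ^+ i)%g (IH g S M gin SM)).
by rewrite size_iota subn0.
Qed.

Hypothesis countableG : countable [set: G].

Lemma enumeration : exists f : nat -> G, forall g, exists n, f n = g.
Proof.
have /countable_injP[e e_inj] := countableG.
pose f n := xget 1%g [set g | e g = n]; exists f => g; exists (e g).
apply: e_inj; rewrite ?in_setT//.
by apply: (@xgetPex _ 1%g [set h | e h = e g]); exists g.
Qed.

(** The weak limit of averages over longer and longer boxes.  The values are
invariant by [folner_averages]; positivity passes to the limit in inner
products, and so does the bimodule property, for which the adjoint of [S1] turns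
a coordinate of [S1 v] into an inner product with [v]. *)
Theorem averaging_expectation : exists E : BH -> BH,
  [/\ (forall (a : R[i]) S S', E (a *: S + S') = a *: E S + E S') /\
        (forall S, opbd (E S) (op_norm S)),
      forall S, invariant_op (E S),
      forall S, invariant_op S -> E S = S,
      forall S, positive_op S -> positive_op (E S) &
      forall S1 S1' S S2, is_adjoint S1 S1' ->
        invariant_op S1 -> invariant_op S2 ->
        E (S1 \* S \* S2) = S1 \* E S \* S2].
Proof.
have [f f_surj] := enumeration.
have [U [ultraU Uoo]] := @ultraFilterLemma nat \oo _.
have ex n : exists l, (0 < size l)%N /\
    forall i S (M : R), (i < n)%N -> opbd S M ->
    opbd (conj_op (f i) (average l S) - average l S) ((n.+1%:R)^-1 * (M + M)).
  have [l l0 h] := folner_averages [seq f i | i <- iota 0 n] n.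
  exists l; split=> // i S M i_n SM; apply: h => //.
  by apply: map_f; rewrite mem_iota.
have [l hl] := choice ex.
have l0 n : (0 < size (l n))%N by case: (hl n).
have exE S : exists A, opbd A (op_norm S) /\
    forall x t, cvg_along U (fun n => average (l n) S x t) (A x t).
  have [A Abd hA] := ultra_weak_limit ultraU (op_norm_ge0 S)
    (fun n => average_opbd (l0 n) (@opbd_op_norm _ _ S)).
  by exists A.
have [E hE] := choice exE.
have Ebd S : opbd (E S) (op_norm S) by case: (hE S).
have EE S x t : cvg_along U (fun n => average (l n) S x t) (E S x t)
  by case: (hE S) => _.
have Einner S x y : cvg_along U (fun n =>
  inner (average (l n) S x) y) (inner (E S x) y).
  apply: (@cvg_along_inner _ _ ultraU _ _ _ _ (op_norm S * ell2_norm x)) =>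
    [n|]; last exact: EE.
  by apply: average_opbd (l0 n) (@opbd_op_norm _ _ S) _.
exists E; split.
- split=> // a S S'; apply: bopP => x; apply: ell2P => t.
  apply: (cvg_along_unique ultraU (EE _ x t)).
  under eq_fun do rewrite average_linear bopD bopZ ell2D ell2Z.
  rewrite bopD bopZ ell2D ell2Z.
  by apply: cvg_alongD => //; apply: cvg_alongZ.
- move=> S g; have [i fi] := f_surj g.
  suff e : conj_op g (E S) = E S.
    apply: bopP => x; rewrite -{2}e bop_compE [RHS]bop_compE conj_opE.
    by rewrite translationK.
  apply: bopP => x; apply: ell2P => t;
    apply: (cvg_along_unique ultraU) (EE S x t).
  have c : cvg_along U (fun n => conj_op g (average (l n) S) x t) (conj_op g (E
    S) x t).
    rewrite conj_opE translationE; under eq_fun do rewrite conj_opE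
      translationE.
    exact: EE.
  apply: (cvg_along_close ultraU c) => e e0.
  set M := op_norm S; set K := (M + M) * ell2_norm x.
  have K0 : 0 <= K by rewrite mulr_ge0 ?addr_ge0 ?op_norm_ge0 ?ell2_norm_ge0.
  apply: Uoo; near=> n.
  change (is_true (normc (average (l n) S x t
    - conj_op g (average (l n) S) x t) < e)).
  rewrite normcB_sym; set D := conj_op g (average (l n) S) - average (l n) S.
  rewrite -[X in normc X]/(D x t) (le_lt_trans (ell2_coord_le _ _))//.
  have i_n : (i < n)%N by near: n; exact: nbhs_infty_gt.
  have [_ /(_ i S M i_n (@opbd_op_norm _ _ S) x)] := hl n; rewrite fi.
  move=> /le_lt_trans; apply; rewrite -mulrA -/K mulrC ltr_pdivrMr// mulrC.
  rewrite -ltr_pdivrMr//; apply: (@lt_trans _ _ n%:R); last by rewrite ltr_nat.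
  by near: n; exact: nbhs_infty_gtr.
- move=> S iS; apply: bopP => x; apply: ell2P => t.
  apply: (cvg_along_unique ultraU (EE S x t)).
  under eq_fun do rewrite average_invariant//.
  exact: cvg_along_cst.
- move=> S S0 x; apply: (cvg_along_ge0 ultraU (Einner S x x)) => n.
  exact: average_positive.
- move=> S1 S1' S S2 adj i1 i2; apply: bopP => x; apply: ell2P => t.
  apply: (cvg_along_unique ultraU (EE _ x t)).
  under eq_fun do rewrite average_bimodule// !bop_compE -inner_delta adj.
  by rewrite !bop_compE -inner_delta adj; exact: Einner.
Unshelve. all: by end_near. Qed.

End Averaging.

(** * Commutants *)

Section Commutants.
Variables (R : realType) (T : choiceType).

Lemma commutant_sub (X Y : set (bop R T)) : X `<=` Y ->
  commutant Y `<=` commutant X.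
Proof. by move=> XY S hS S' /XY; exact: hS. Qed.

Lemma sub_bicommutant (X : set (bop R T)) : X `<=` commutant (commutant X).
Proof. by move=> S XS S' hS'; rewrite hS'. Qed.

Lemma commutant_von_neumann (X : set (bop R T)) :
  (forall S S', is_adjoint S S' -> commutant X S -> commutant X S') ->
  von_neumann_algebra (commutant X).
Proof.
move=> adj; split=> //; apply/seteqP; split; last exact: sub_bicommutant.
exact: commutant_sub (@sub_bicommutant X).
Qed.

End Commutants.

(** * The formula on monomials *)

Section GroupAlgebra.
Variables (R : realType) (G : groupType) (P : monoidType) (theta : P -> G -> G).
Variables (Q : cstarAlgType R) (u : G -> Q) (s : P -> Q) (pi : Q -> bop R G).
Hypothesis hADS : algebraic_dynamical_system theta.
Hypothesis hG : forall g h : G, (g * h = h * g)%g.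
Hypothesis hu : unitary_representation u.
Hypothesis hs : isometric_representation s.
Hypothesis hrep : star_representation pi.
Hypothesis hdelta : forall g p h,
  pi (u g * s p) (delta R h) = delta R (g * theta p h)%g.

Notation L := (fun g => pi (u g)).

Lemma unitary_star g : star (u g) = u g^-1%g.
Proof.
case: hu => u1 uM uu.
by rewrite -[LHS]mulr1 -u1 -(mulgV g) uM mulrA (uu g).1 mul1r.
Qed.

Lemma translation_delta g h : pi (u g) (delta R h) = delta R (g * h)%g.
Proof.
case: hs hADS => s1 _ _ [_ _ _ [th1 _] _].
by have := hdelta g 1%g h; rewrite s1 mulr1 th1.
Qed.

Lemma rep_translation_adj g : is_adjoint (L g) (L g^-1%g).
Proof. by move=> x y; rewrite (rep_adj hrep) unitary_star. Qed.

Lemma rep_translationE g x t : pi (u g) x t = x (g^-1 * t)%g.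
Proof.
rewrite -inner_delta (rep_translation_adj g) translation_delta.
exact: inner_delta.
Qed.

Lemma rep_translation_opbd g : opbd (L g) 1.
Proof.
apply: (opbd_le _ (rep_contractive hrep (u g))); apply: cnorm_isometry_le1.
by case: hu => _ _ /(_ g)[].
Qed.

Lemma group_cstar_central x g : group_cstar u x -> x * u g = u g * x.
Proof.
case: hu => u1 uM uu.
pose Z := [set x : Q | forall g, x * u g = u g * x].
suff sub : group_cstar u `<=` Z by move=> /sub; exact.
apply: smallest_sub => [|_ [h _ <-] k]; last by rewrite -!uM hG.
split.
- split=> [k|a y z Zy Zz k]; first by rewrite mul0r mulr0.
  by rewrite mulrDl mulrDr -scalerAl -scalerAr Zy Zz.
- by move=> y z Zy Zz k; rewrite -mulrA Zz mulrA Zy mulrA.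
- move=> y Zy k; rewrite -[u k]starK -!starM unitary_star.
  by rewrite Zy.
- move=> y l Zy yl k.
  apply: (@clim_unique _ _ (fun n => y n * u k)).
    exact: climM yl (clim_cst _).
  under eq_fun do rewrite Zy.
  exact: climM (clim_cst _) yl.
Qed.

(** Since [G] is abelian, [C*(G)] commutes with the translations; the commutant
of the translations, being a von Neumann algebra, then contains [W*(G)]. *)
Lemma group_von_neumann_invariant S : group_von_neumann u pi S ->
  invariant_op L S.
Proof.
have e : invariant_op L = commutant (range L).
  apply/funext => A; apply/propext; split => [h _ [g _ <-]|h g].
    exact/esym/h.
  by apply/esym/h; exists g.
have vN : von_neumann_algebra (commutant (range L)).
  apply: commutant_von_neumann => A A' adj; rewrite -e => iA g.
  apply: bopP => y; apply: inner_inj => z; rewrite !bop_compE.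
  rewrite innerC [RHS]innerC; congr (_^*).
  have adjV x x' : inner (L g^-1%g x) x' = inner x (L g x').
    by have := @rep_translation_adj g^-1%g x x'; rewrite invgK.
  have iA' : pi (u g^-1%g) \* A = A \* pi (u g^-1%g) := iA g^-1%g.
  rewrite -(adj z (pi (u g) y)) -(adjV (A z) y) -(adjV z (A' y)) -adj.
  congr (inner _ y).
  exact: (congr1 (fun S : bop R G => S z) (esym iA')).
rewrite e; move: S; apply: smallest_sub => // _ [x xG <-].
rewrite -e => g; rewrite -!(repM hrep); congr pi.
by rewrite group_cstar_central.
Qed.

Lemma translation_group_von_neumann g : group_von_neumann u pi (L g).
Proof.
apply: sub_gen_smallest; exists (u g) => //.
by apply: sub_gen_smallest; exists g.
Qed.

Lemma theta_morph p g h : theta p (g * h)%g = (theta p g * theta p h)%g.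
Proof. by case: hADS => _ _ [th _] _ _; exact: th. Qed.

Lemma theta1 p : theta p 1%g = 1%g.
Proof. by apply: (@mulgI _ (theta p 1%g)); rewrite -theta_morph !mulg1. Qed.

Lemma thetaV p g : theta p g^-1%g = (theta p g)^-1%g.
Proof. by apply: (@mulgI _ (theta p g));
  rewrite -theta_morph !mulgV theta1. Qed.

Lemma PhiM p q g h : Phi theta p q (g * h)%g = (Phi theta p q g * Phi theta p q
  h)%g.
Proof.
rewrite /Phi !thetaV !theta_morph invgM -!mulgA; congr (_ * _)%g.
by rewrite [RHS]hG -mulgA.
Qed.

Lemma PhiX p q g n : Phi theta p q (g ^+ n)%g = (Phi theta p q g ^+ n)%g.
Proof.
elim: n => [|n IH]; last by rewrite !expgS PhiM IH.
by rewrite !expg0 /Phi invg1 !theta1 mulg1.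
Qed.

Lemma Phi_infinite_order p q g : infinite_order g ->
  set_inj (cyclic_subgroup g) (Phi theta p q) ->
  infinite_order (Phi theta p q g).
Proof.
move=> g_inf inj n n0; rewrite -PhiX => e; apply: (g_inf n n0).
have e1 : Phi theta p q 1%g = 1%g by rewrite /Phi invg1 !theta1 mulg1.
apply: inj; rewrite ?e ?e1//; apply/mem_set.
  by exists n; left.
by exists 0%N; left; rewrite expg0.
Qed.

(** The coordinates of a vector fixed by a translation of infinite order are
constant along infinite orbits, which square summability forbids unless they
vanish. *)
Lemma translation_fixed_eq0 k (x : ell2 R G) : infinite_order k ->
  L k x = x -> x = 0.
Proof.
move=> k_inf kx; apply: ell2P => t; rewrite ell2_0.
have orb n : x (k ^+ n * t)%g = x t.
  elim: n => [|n IH]; first by rewrite expg0 mul1g.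
  by rewrite -{1}kx rep_translationE expgS -mulgA mulKg.
have inj : injective (fun n => (k ^+ n * t)%g).
  suff le i j : (i <= j)%N -> (k ^+ i)%g = (k ^+ j)%g -> i = j.
    by move=> i j /mulIg e; have [/le->//|/ltnW/le->//] := leqP i j.
  move=> ij; rewrite -{1}(subnKC ij) expgnDr -{1}[(k ^+ i)%g]mulg1 => /mulgI e.
  apply/eqP; rewrite eqn_leq ij /= -subn_eq0; apply: contraT; rewrite -lt0n.
  by move=> /k_inf; rewrite -e.
apply/eq0_normc/eqP; rewrite -sqrf_eq0 eq_le sqr_ge0 andbT.
rewrite leNgt; apply/negP => xt0.
pose N := Num.truncn (ell2_norm x ^+ 2 / normc (x t) ^+ 2).
pose F := [fset y in [seq (k ^+ i * t)%g | i <- iota 0 N.+1]]%fset.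
have cF : size F = N.+1.
  rewrite /F card_fseq undup_id ?size_map ?size_iota//.
  by rewrite map_inj_uniq ?iota_uniq.
have := sum_fset_le_norm x F.
have -> : \sum_(y <- F) normc (x y) ^+ 2 = \sum_(y <- F) normc (x t) ^+ 2.
  rewrite big_seq [RHS]big_seq; apply: eq_bigr => y; rewrite /F in_fset.
  by move=> /mapP[i _ ->]; rewrite orb.
rewrite big_const_seq count_predT iter_addr addr0 cF -[_ *+ _]mulr_natl.
by apply/negP; rewrite -ltNge -ltr_pdivrMr// truncnS_gt.
Qed.

Section Formula.
Variable E : bop R G -> bop R G.
Hypothesis E_linear : forall (a : R[i]) S S', E (a *: S + S') = a *: E S + E S'.
Hypothesis E_id : E (bop_id R G) = bop_id R G.
Hypothesis E_invariant : forall S, invariant_op L (E S).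
Hypothesis E_bimodule : forall g S h, E (L g \* S \* L h) = L g \* E S \* L h.

Lemma expectation0 : E 0 = 0.
Proof.
have := E_linear (-1) 0 0; rewrite scaler0 addr0 => ->.
by rewrite scaleN1r addNr.
Qed.

Lemma expectation_sum I (r : seq I) (F : I -> bop R G) :
  E (\sum_(i <- r) F i) = \sum_(i <- r) E (F i).
Proof.
elim: r => [|i r IH]; first by rewrite !big_nil expectation0.
by rewrite !big_cons -[F i]scale1r E_linear !scale1r IH.
Qed.

Hypothesis hI : relationI theta u s.

(** With [T = s_p s_q^*], relation (I) gives [T = u_{theta_p(h)} T
u_{theta_q(h)}^*] for every [h], so that [E T] is fixed by the translation by
[Phi_{p,q}(h)]; some such translation has infinite order. *)
Lemma expectation_off_diagonal p q :
  (exists g : G, infinite_order g /\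
     set_inj (cyclic_subgroup g) (Phi theta p q)) ->
  E (pi (s p * star (s q))) = 0.
Proof.
move=> [g [g_inf inj]].
have k_inf := Phi_infinite_order g_inf inj; set k := Phi theta p q g in k_inf.
have e : pi (s p * star (s q)) =
    L (theta p g) \* pi (s p * star (s q)) \* L (theta q g^-1)%g.
  rewrite -!(repM hrep); congr pi.
  rewrite mulrA -hI -!mulrA; congr (_ * _).
  rewrite thetaV -unitary_star -starM -hI starM mulrA.
  by case: hu => _ _ /(_ g)[_ ->]; rewrite mul1r.
apply: bopP => x; rewrite bop0; apply: (translation_fixed_eq0 k_inf).
rewrite [in RHS]e E_bimodule !bop_compE -[E _ (_ x)]bop_compE -E_invariant
  bop_compE.
rewrite -[RHS]bop_compE -(repM hrep) /k /Phi.
by case: hu => _ -> _.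
Qed.

Hypothesis hIII : relationIII theta u s.
Hypothesis hN : forall p : P, finite_set (cosets theta p).

Lemma coset_eqP p g t : [set (g * x)%g | x in range (theta p)] t <->
  range (theta p) (t^-1 * g)%g.
Proof.
split=> [[_ [x _ <-] <-]|[x _ e]].
  by exists x^-1%g; rewrite // thetaV invgM -mulgA mulVg mulg1.
exists (theta p x^-1%g); first by exists x^-1%g.
by rewrite thetaV e invgM invgK mulgA mulgV mul1g.
Qed.

Lemma range_thetaM p g h : range (theta p) g -> range (theta p) h ->
  range (theta p) (g * h)%g.
Proof. by move=> [x _ <-] [y _ <-]; exists (x * y)%g;
  rewrite // theta_morph. Qed.

Lemma range_thetaV p g : range (theta p) g -> range (theta p) g^-1%g.
Proof. by move=> [x _ <-]; exists x^-1%g; rewrite // thetaV. Qed.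

Lemma coset_eq p g t : range (theta p) (t^-1 * g)%g ->
  [set (g * x)%g | x in range (theta p)] = [set (t * x)%g | x in range (theta
    p)].
Proof.
move=> tg; apply/seteqP; split=> y /coset_eqP h; apply/coset_eqP.
  have := range_thetaM h (range_thetaV tg).
  by rewrite invgM invgK -mulgA mulVKg.
by have := range_thetaM h tg; rewrite -mulgA mulVKg.
Qed.

(** One representative per coset: this links the sum of relation (III), which
runs over a system of representatives, to [Nindex], which counts cosets. *)
Lemma coset_system p : exists2 T : {fset G}, coset_representatives theta p T &
  #|` T| = Nindex theta p.
Proof.
pose rep (A : set G) : G := xget 1%g A.
have repP A : cosets theta p A -> A (rep A).
  move=> [g ->]; apply: (@xgetPex _ 1%g); exists g, 1%g; rewrite ?mulg1//.
  by exists 1%g; rewrite ?theta1.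
have repE A : cosets theta p A -> A = [set (rep A * x)%g | x in range (theta
  p)].
  move=> cA; have := repP _ cA; case: (cA) => g {1 3}-> /coset_eqP.
  exact: coset_eq.
exists [fset rep A | A in fset_set (cosets theta p)]%fset.
  move=> g; pose A := [set (g * x)%g | x in range (theta p)].
  have cA : cosets theta p A by exists g.
  exists (rep A); split.
    split; last by apply/coset_eqP; exact: repP.
    by apply/imfsetP; exists A => //=; rewrite in_fset_set// inE.
  move=> t [/imfsetP[B /=]]; rewrite in_fset_set// inE => cB -> /coset_eq.
  by rewrite -/A -(repE _ cB) => ->.
rewrite card_in_imfset//= => A B; rewrite !in_fset_set// !inE => cA cB e.
by rewrite (repE _ cA) e -(repE _ cB).
Qed.

(** The translates of [s_p s_p^*] by coset representatives add up to [1] by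
relation (III), and [E] takes the same value on all of them. *)
Lemma expectation_diagonal p :
  E (pi (s p * star (s p))) = (Nindex theta p)%:R^-1 *: bop_id R G.
Proof.
have [T repT <-] := coset_system p.
have := hIII (hN p) repT => /(congr1 pi); rewrite (rep_sum hrep) (rep1 hrep).
move/(congr1 E); rewrite expectation_sum E_id.
rewrite (eq_bigr (fun=> E (pi (s p * star (s p))))) => [|g _]; last first.
  rewrite -(mulrA (u g)) !(repM hrep) -(repM hrep (s p)) unitary_star
    E_bimodule.
  apply: bopP => x; rewrite !bop_compE -[E _ (_ x)]bop_compE -E_invariant
    bop_compE.
  by rewrite -[LHS]bop_compE -(repM hrep) -unitary_star;
    case: hu => _ _ /(_ g)[_ ->];
    rewrite (rep1 hrep).
move=> e; have T0 : (0 < size T)%N.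
  by have [t [[tT _] _]] := repT 1%g; rewrite -has_predT; apply/hasP; exists t.
by rewrite -e -real_natV mean_cst.
Qed.

Lemma expectation_monomial p q g h :
  (p <> q -> exists g : G, infinite_order g /\
     set_inj (cyclic_subgroup g) (Phi theta p q)) ->
  E (pi (u g * s p * star (s q) * star (u h))) =
    ((p == q)%:R * (Nindex theta p)%:R^-1) *: pi (u (g * h^-1)%g).
Proof.
move=> hPhi; rewrite -[_ * s p * _]mulrA unitary_star !(repM hrep).
rewrite -(repM hrep (s p)) E_bimodule.
apply: bopP => x; rewrite !bop_compE bopZ.
have [pq|/eqP pq] := eqVneq p q; last first.
  by rewrite (expectation_off_diagonal (hPhi pq)) mul0r scale0r bop0 bop0_arg.
rewrite -pq expectation_diagonal mul1r bopZ bop_idE bopZ_arg; congr (_ *: _).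
by rewrite -bop_compE -(repM hrep); case: hu => _ -> _.
Qed.

End Formula.

End GroupAlgebra.

(** * Density of the monomials and extension to the boundary quotient *)

Section MonomialDensity.
Variables (R : realType) (G : groupType) (P : monoidType) (theta : P -> G -> G).
Variables (Q : cstarAlgType R) (u : G -> Q) (s : P -> Q).
Hypothesis hrel : boundary_relations theta u s.
Hypothesis hgen : cstar_generated (range u `|` range s) = [set: Q].

Definition closed_subspace (K : set Q) : Prop :=
  [/\ K 0, forall (a : R[i]) x y, K x -> K y -> K (a *: x + y) &
      forall (x : nat -> Q) l, (forall n, K (x n)) -> clim x l -> K l].

Definition monomial g p q h : Q := u g * s p * star (s q) * star (u h).

Definition monomials : set Q :=
  [set x | exists g p q h, x = monomial g p q h].

Lemma monomial_star g p q h : star (monomial g p q h) = monomial h q p g.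
Proof. by rewrite /monomial !starM !starK -!mulrA. Qed.

(** Relation (II) rewrites the inner factor [s_q^* u_g s_p] of a product of two
monomials, and relation (I) moves the group elements outwards. *)
Lemma monomialM g p q h g' p' q' h' :
  monomial g p q h * monomial g' p' q' h' = 0 \/
  monomials (monomial g p q h * monomial g' p' q' h').
Proof.
case: hrel => -[u1 uM uu] [s1 sM ss] hI [hII hII0] _.
have us k : star (u k) = u k^-1%g by apply: unitary_star; split.
have -> : monomial g p q h * monomial g' p' q' h' =
    u g * s p * (star (s q) * u (h^-1 * g')%g * s p') * star (s q') * star (u
      h').
  by rewrite /monomial us uM !mulrA.
have [[g1 [g2 [a [b hab]]]]|no] := pselect (exists g1 g2 a b,
    relationII_data theta q p' (h^-1 * g')%g g1 g2 a b).
  right; rewrite (hII _ _ _ _ _ _ _ hab).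
  exists (g * theta p g1)%g, (p * a)%g, (q' * b)%g, (h' * theta q' g2^-1)%g.
  have e1 : s p * u g1 = u (theta p g1) * s p by exact: hI.
  have e2 : u g2 * star (s q') = star (s q') * star (u (theta q' g2^-1)%g).
    by rewrite -[u g2]starK us -starM hI starM.
  rewrite /monomial !uM !sM !starM -!mulrA (mulrA (u g2)) e2 !mulrA.
  by rewrite -(mulrA (u g)) e1 !mulrA.
by left; rewrite (hII0 _ _ _ no) mulr0 !mul0r.
Qed.

(** The closed linear span of the monomials is a C*-subalgebra by [monomialM],
and it contains the generators. *)
Lemma monomial_dense (K : set Q) :
  closed_subspace K -> monomials `<=` K -> K = [set: Q].
Proof.
case: (hrel) => hu [s1 sM ss] hI _ _; have [u1 uM uu] := hu.
have us k : star (u k) = u k^-1%g by exact: unitary_star.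
move=> cK mK; apply/seteqP; split=> // x _.
pose W : set Q := [set y | forall K, closed_subspace K -> monomials `<=` K ->
  K y].
suff : W x by exact.
have Wlin : closed_subspace W.
  split=> [K' []//|a y z Wy Wz K' cK' mK'|y l Wy yl K' cK' mK'].
    by case: (cK') => _ lin _; apply: lin; [exact: Wy|exact: Wz].
  by case: (cK') => _ _ cl; apply: cl yl => n; exact: Wy.
have Wm : monomials `<=` W by move=> y my K' _; exact.
have [W0 Wl Wc] := Wlin.
have Wind (K' : set Q) : closed_subspace K' -> monomials `<=` K' -> W `<=` K'.
  by move=> cK' mK' y; exact.
have Wstar : W `<=` [set y | W (star y)].
  apply: Wind; last first.
    by move=> _ [g [p [q [h ->]]]] /=; rewrite monomial_star; apply: Wm;
      exists h, q, p, g.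
  split=> [|a y z /= Wy Wz|y l /= Wy yl]; rewrite /= ?star0//.
    by rewrite starD starZ; exact: Wl.
  exact: Wc Wy (clim_star yl).
have WmM m : monomials m -> W `<=` [set y | W (m * y)].
  move=> [g [p [q [h ->]]]]; apply: Wind; last first.
    move=> _ [g' [p' [q' [h' ->]]]] /=.
    by have [->//|/Wm] := monomialM g p q h g' p' q' h'.
  split=> [|a y z /= Wy Wz|y l /= Wy yl]; rewrite /= ?mulr0//.
    by rewrite mulrDr -scalerAr; exact: Wl.
  by apply: Wc Wy _; exact: climM (clim_cst _) yl.
have WM y z : W y -> W z -> W (y * z).
  move=> Wy Wz; suff : W `<=` [set y | W (y * z)] by apply.
  apply: Wind => [|m mm]; last exact: WmM.
  split=> [|a y1 y2 /= Wy1 Wy2|y1 l /= Wy1 yl]; rewrite /= ?mul0r//.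
    by rewrite mulrDl -scalerAl; exact: Wl.
  by apply: Wc Wy1 _; exact: climM yl (clim_cst _).
have : [set: Q] x by [].
rewrite -hgen; apply: (@smallest_sub _ _ _ W).
  by split; [split|exact: WM|exact: Wstar|exact: Wc].
move=> _ [[g _ <-]|[p _ <-]]; apply: Wm.
  by exists g, 1%g, 1%g, 1%g; rewrite /monomial s1 u1 star1 !mulr1.
by exists 1%g, p, 1%g, 1%g; rewrite /monomial s1 u1 star1 !mulr1 mul1r.
Qed.

End MonomialDensity.

Lemma cstar_generated_subalgebra (R : realType) (A : cstarAlgType R) (X :
  set A) :
  cstar_subalgebra (cstar_generated X).
Proof.
split.
- split=> [B [[[B0 _] _ _ _] _]//|a x y hx hy B BX].
  by have [[[_ lin] _ _ _] _] := BX; apply: lin; [exact: hx|exact: hy].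
- move=> x y hx hy B BX.
  by have [[_ mul _ _] _] := BX; apply: mul; [exact: hx|exact: hy].
- move=> x hx B BX.
  by have [[_ _ st _] _] := BX; apply: st; exact: hx.
- move=> x l hx xl B BX.
  by have [[_ _ _ cl] _] := BX; apply: cl xl => n; exact: hx.
Qed.

Section CanonicalExpectation.
Variables (R : realType) (G : groupType) (P : monoidType) (theta : P -> G -> G).
Variables (Q : cstarAlgType R) (u : G -> Q) (s : P -> Q) (pi : Q -> bop R G).
Hypothesis hrep : star_representation pi.
Hypothesis hrel : boundary_relations theta u s.
Hypothesis hgen : cstar_generated (range u `|` range s) = [set: Q].

Lemma rep_clim (x : nat -> Q) l : clim x l -> forall e : R, 0 < e ->
  exists n, opbd (pi (x n - l)) e.
Proof.
move=> /clim_small h e /h[N hN]; exists N.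
exact: opbd_le (ltW (hN N (leqnn N))) (rep_contractive hrep _).
Qed.

Variables E F : bop R G -> bop R G.
Hypothesis E_linear : forall (a : R[i]) S S', E (a *: S + S') = a *: E S + E S'.
Hypothesis F_linear : forall (a : R[i]) S S', F (a *: S + S') = a *: F S + F S'.
Hypothesis E_opbd : forall S, opbd (E S) (op_norm S).
Hypothesis F_opbd : forall S, opbd (F S) (op_norm S).

Lemma linear_opB (D : bop R G -> bop R G) :
  (forall (a : R[i]) S S', D (a *: S + S') = a *: D S + D S') ->
  forall S S', D (S - S') = D S - D S'.
Proof.
by move=> lin S S'; rewrite addrC -scaleN1r lin scaleN1r addrC.
Qed.

Lemma expectation_close (D : bop R G -> bop R G)
    (hD : forall S, opbd (D S) (op_norm S)) x (e : R) :
  0 < e -> opbd (pi x) e -> opbd (D (pi x)) e.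
Proof.
by move=> e0 xe; apply: opbd_le (hD _); apply: op_norm_le => //; exact: ltW.
Qed.

Lemma expectation_unique :
  (forall g p q h, E (pi (monomial u s g p q h)) = F (pi (monomial u s g p q
    h))) ->
  forall x, E (pi x) = F (pi x).
Proof.
move=> EF x; have : [set: Q] x by [].
rewrite -(monomial_dense hrel hgen (K := [set x | E (pi x) = F (pi x)])) //.
  split=> [|a y z /= Ey Ez|y l /= Ey yl].
  - by rewrite /= (rep0 hrep) (expectation0 E_linear) (expectation0 F_linear).
  - by rewrite (rep_linear hrep) E_linear F_linear Ey Ez.
  - apply/eqP; rewrite -subr_eq0; apply/eqP/opbd_small_eq0 => e e0.
    have e20 : 0 < e / 2 by rewrite divr_gt0.
    have [n hn] := rep_clim yl e20.
    have -> : E (pi l) - F (pi l) = F (pi (y n - l)) - E (pi (y n - l)).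
      rewrite !(repB hrep) (linear_opB E_linear) (linear_opB F_linear) Ey.
      by rewrite opprB [RHS]addrC subrKA.
    rewrite [e](splitr e); apply: opbdB; exact: expectation_close.
by move=> _ [g [p [q [h ->]]]]; exact: EF.
Qed.

Hypothesis pi_inj : injective pi.

(** Since [pi] is isometric, [pi(C*(G))] is closed: convergence of the values
[E(pi y_n)] is convergence of their preimages in [C*(G)].  So it is enough to
know where the monomials are sent. *)
Lemma expectation_range :
  (forall g p q h, (pi @` group_cstar u) (E (pi (monomial u s g p q h)))) ->
  forall x, (pi @` group_cstar u) (E (pi x)).
Proof.
move=> EF x; have : [set: Q] x by [].
have [[C0 Clin] CM Cstar Cclosed] : cstar_subalgebra (group_cstar u).
  exact: cstar_generated_subalgebra.
rewrite -(monomial_dense hrel hgen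
  (K := [set x | (pi @` group_cstar u) (E (pi x))])) //.
  split=> [|a y z /= [y' Cy' ey] [z' Cz' ez]|y l /= Ey yl].
  - by rewrite /= (rep0 hrep) (expectation0 E_linear); exists 0;
    rewrite ?(rep0 hrep).
  - rewrite (rep_linear hrep) E_linear -ey -ez; exists (a *: y' + z').
      exact: Clin.
    by rewrite (rep_linear hrep).
  - have ex n : exists z, group_cstar u z /\ pi z = E (pi (y n)).
      by have [z Cz ez] := Ey n; exists z.
    have [z hz] := choice ex.
    have zy n (e : R) x' : 0 < e -> opbd (pi (y n - x')) e ->
      opbd (pi (z n) - E (pi x')) e.
      move=> e0 h; rewrite (hz n).2 -(linear_opB E_linear) -(repB hrep).
      exact: expectation_close.
    have zcauchy (e : R) : 0 < e -> exists N : nat, forall m n : nat,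
        (N <= m)%N -> (N <= n)%N -> cnorm (z m - z n) < e.
      move=> e0; have e40 : 0 < e / 4 by rewrite divr_gt0.
      have [N hN] := clim_small yl e40; exists N => m n Nm Nn.
      suff : cnorm (z m - z n) <= e / 2 by lra.
      apply: (rep_isometric hrep pi_inj); first by lra.
      rewrite (repB hrep) (hz n).2; apply: zy; first by lra.
      apply: opbd_le (rep_contractive hrep _).
      rewrite -(subrKA l) (le_trans (cnormD _ _))// [cnorm (l - _)]cnormB.
      by have := hN _ Nm; have := hN _ Nn; lra.
    have [w zw] := cnorm_complete _ zcauchy.
    exists w; first exact: Cclosed (fun n => (hz n).1) zw.
    apply/eqP; rewrite -subr_eq0; apply/eqP/opbd_small_eq0 => e e0.
    have e20 : 0 < e / 2 by rewrite divr_gt0.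
    have [N hN] := clim_small yl e20; have [N' hN'] := clim_small zw e20.
    set n := maxn N N'.
    have h1 := hN n (leq_maxl _ _); have h2 := hN' n (leq_maxr _ _).
    rewrite -(subrKA (pi (z n))) [e](splitr e); apply: opbdD.
      rewrite -(repB hrep); apply: opbd_le (rep_contractive hrep _).
      by rewrite cnormB ltW.
    by apply: zy => //; apply: opbd_le (ltW h1) (rep_contractive hrep _).
by move=> _ [g [p [q [h ->]]]]; exact: EF.
Qed.

End CanonicalExpectation.

(** * The expectation onto the group algebra *)

Theorem proposition3p3 (R : realType) (G : groupType) (P : monoidType)
    (theta : P -> G -> G)
    (hADS : algebraic_dynamical_system theta)
    (hG : forall g h : G, (g * h = h * g)%g)
    (hP : directed P)
    (hN : forall p : P, finite_set (cosets theta p))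
    (Q : cstarAlgType R) (u : G -> Q) (s : P -> Q)
    (hQ : boundary_quotient theta u s)
    (pi : Q -> bop R G)
    (hpi : canonical_representation theta u s pi)
    (hfaithful : injective pi)
    (hPhi : forall p q : P, p <> q ->
       exists g : G, infinite_order g /\
         set_inj (cyclic_subgroup g) (Phi theta p q)) :
  (forall E : bop R G -> bop R G,
     conditional_expectation [set: bop R G] (group_von_neumann u pi) E ->
     forall (g h : G) (p q : P),
       E (pi (u g * s p * star (s q) * star (u h))) =
       ((p == q)%:R * (Nindex theta p)%:R^-1) *: pi (u (g * h^-1)%g)) /\
  (exists E0 : bop R G -> bop R G,
     [/\ conditional_expectation (range pi) (pi @` group_cstar u) E0,
         (forall (g h : G) (p q : P),
            E0 (pi (u g * s p * star (s q) * star (u h))) =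
            ((p == q)%:R * (Nindex theta p)%:R^-1) *: pi (u (g * h^-1)%g)) &
         forall E : bop R G -> bop R G,
           conditional_expectation [set: bop R G] (group_von_neumann u pi) E ->
           forall T, range pi T -> E T = E0 T]).
Proof.
have hrel : boundary_relations theta u s by case: hQ.
have hgen : cstar_generated (range u `|` range s) = [set: Q] by case: hQ.
have [hu hs hI _ hIII] := hrel.
have [hrep hdelta] := hpi.
have uW := @translation_group_von_neumann _ _ _ u pi.
pose L g := pi (u g).
have formula (E : bop R G -> bop R G) :
    (forall (a : R[i]) S S', E (a *: S + S') = a *: E S + E S') ->
    E (bop_id R G) = bop_id R G -> (forall S, invariant_op L (E S)) ->
    (forall g S h, E (L g \* S \* L h) = L g \* E S \* L h) ->
    forall g h p q, E (pi (u g * s p * star (s q) * star (u h))) =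
      ((p == q)%:R * (Nindex theta p)%:R^-1) *: pi (u (g * h^-1)%g).
  move=> lin id inv bim g h p q.
  exact: (expectation_monomial hADS hG hu hs hrep hdelta lin id inv bim
    hI hIII hN g h (hPhi p q)).
have L1 : L 1%g = bop_id R G by rewrite /L; case: hu => -> _ _; exact: rep1.
have part1 (E : bop R G -> bop R G) :
    conditional_expectation [set: bop R G] (group_von_neumann u pi) E ->
    forall g h p q, E (pi (u g * s p * star (s q) * star (u h))) =
      ((p == q)%:R * (Nindex theta p)%:R^-1) *: pi (u (g * h^-1)%g).
  move=> [[_ EW] fixW lin _ bim]; apply: formula.
  - by move=> a S S'; exact: lin.
  - by rewrite -L1 fixW//; exact: uW.
  - by move=> S; apply: (group_von_neumann_invariant hG hu hrep); exact: EW.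
  - by move=> g S h; apply: bim => //; exact: uW.
split=> //.
have [hGc _ _ _ _] := hADS.
have [E0 [[E0lin E0bd] E0inv E0fix E0pos E0bim]] := averaging_expectation
  hG (rep_translationE hADS hu hs hrep hdelta) (rep_translation_adj hu hrep)
  (rep_translation_opbd hu hrep) hGc.
have Linv g : invariant_op L (L g).
  exact: translation_invariant hG (rep_translationE hADS hu hs hrep hdelta) g.
have cstar_inv x : group_cstar u x -> invariant_op L (pi x).
  by move=> Cx g; rewrite /L -!(repM hrep) (group_cstar_central hG hu).
have E0formula : forall g h p q, E0 (pi (u g * s p * star (s q) * star (u h))) =
      ((p == q)%:R * (Nindex theta p)%:R^-1) *: pi (u (g * h^-1)%g).
  apply: formula => //; first by rewrite E0fix// -L1.
  move=> g S h.
  exact: (E0bim _ _ _ _ (rep_translation_adj hu hrep g) (Linv g) (Linv h)).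
exists E0; split=> //.
- split.
  + split; first by move=> _ [x _ <-]; exists x.
    move=> _ [x _ <-].
    apply: (expectation_range hrep hrel hgen E0lin E0bd hfaithful).
    move=> g p q h; rewrite /monomial E0formula -(repZ hrep).
    set c := _ * _; exists (c *: u (g * h^-1)%g) => //.
    have [[C0 Clin] _ _ _] := cstar_generated_subalgebra (range u).
    rewrite -[_ *: _]addr0; apply: Clin => //.
    by apply: sub_gen_smallest; exists (g * h^-1)%g.
  + by move=> _ [x Cx <-]; rewrite E0fix//; exact: cstar_inv.
  + by move=> a S S' _ _; exact: E0lin.
  + split=> S _; last exact: E0pos.
    by apply: op_norm_le (op_norm_ge0 _) _.
  + move=> _ S _ [x Cx <-] _ [y Cy <-].
    exact: (E0bim _ _ _ _ (rep_adj hrep x) (cstar_inv x Cx) (cstar_inv y Cy)).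
- move=> E hE _ [x _ <-].
  have [_ _ lin [Ebd _] _] := hE.
  apply: (expectation_unique hrep hrel hgen _ E0lin _ E0bd)
    => [a S S'|S|g p q h].
  + exact: lin.
  + exact: opbd_le (Ebd S _) (opbd_op_norm _).
  + by rewrite /monomial part1// E0formula.
Qed.
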